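(* Let $T\ge 1$, let $\Sigma_u$ be a symmetric positive definite $T\times T$ matrix, and let $\mathcal{U}$ be a Gaussian process on $\mathbb{R}^T\times\mathbb{R}^T$ with stationary squared exponential covariance $$k_u([x,y],[v,w])=\sigma_u^2\exp\left(-\tfrac12 (x-v)^\intercal\Sigma_u^{-1}(x-v)-\tfrac12 (y-w)^\intercal\Sigma_u^{-1}(y-w)\right),\qquad \sigma_u>0.$$ Let $\mathcal{F}(x,y)=\mathcal{U}(x,y)-\mathcal{U}(y,x)$ with $\mathbb{E}[\mathcal{F}(x,y)]=0$ for all $x,y$. Let the attributes be i.i.d. multivariate Gaussian with covariance $\Sigma_x=\sigma_x^2 I$, drawn independently of $\mathcal{F}$, and suppose $\Sigma_u^{-1}\Sigma_x=r^2I$ for a scalar $r>0$ (the roughness coefficient). Then, in the limit as $r\to\infty$, the shared-endpoint correlation $\rho(r)$ has the expansion $$\rho(r)\simeq(\sqrt2\,r)^{-T}+\mathcal{O}(r^{-2T})\xrightarrow{r\to\infty}0,$$ that is, leading term $(\sqrt2\,r)^{-T}$ with error of order $\mathcal{O}(r^{-2T})$.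
   Context: Let $X,Y,W$ be i.i.d. draws from the attribute distribution $\pi_X$, independent of the random skew-symmetric function $\mathcal{F}$. The variance and the shared-endpoint correlation are $$\sigma^2=\mathbb{E}_{\mathcal{F}}\left[\mathrm{Var}_{X,Y}(\mathcal{F}(X,Y)\mid\mathcal{F})\right],\qquad \rho=\frac{1}{\sigma^2}\,\mathbb{E}_{\mathcal{F}}\left[\mathrm{Cov}_{X,Y,W}(\mathcal{F}(X,Y),\mathcal{F}(X,W)\mid\mathcal{F})\right].$$ Under these hypotheses $\rho$ depends only on $r$ and $T$.
   Formalization: The error order O(r^{-2T}) is false for T≥3, where the error has exact order r^{-(T+2)}; the formal theorem proves error O(r^{-2T}) for T≤2 and O(r^{-2T}+r^{-(T+2)}) for all T≥1, with ρ asymptotic to (√2 r)^{-T} plus an O(r^{-2T}) term, and ρ→0. *)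

(* Defs.v *)
From HB Require Import structures.
From mathcomp Require Import all_boot all_order all_algebra.
From mathcomp Require Import all_classical all_reals all_analysis.

Set Implicit Arguments.
Unset Strict Implicit.
Unset Printing Implicit Defensive.

Import Order.TTheory GRing.Theory Num.Theory.
Import numFieldNormedType.Exports.

Local Open Scope classical_set_scope.
Local Open Scope ring_scope.

(* Makes the library's Landau notations usable at +oo. *)
Canonical pinfty_filter_on (R : numFieldType) : filter_on R :=
  FilterType (pinfty_nbhs R) (@proper_pinfty_nbhs R).

(* Points of R^T are T-tuples, whose library sigma-algebra is generated by the
   coordinate projections, i.e. is the Borel sigma-algebra of R^T. *)
Definition colv (R : realType) (T : nat) (x : T.-tuple R) : 'cV[R]_T :=
  \col_i tnth x i.

Definition quad_form (R : realType) (T : nat) (M : 'M[R]_T) (z : 'cV[R]_T) : R :=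
  (z^T *m M *m z) 0 0.

Definition sym_posdef (R : realType) (T : nat) (M : 'M[R]_T) : Prop :=
  M^T = M /\ forall z : 'cV[R]_T, z != 0 -> 0 < quad_form M z.

(* The normal law with mean m and variance v, with N(m, 0) the Dirac mass at m.
   (The library's [normal_prob] takes the standard deviation, and for standard
   deviation 0 it is the uniform law on [0, 1].) *)
Definition normal_law (R : realType) (m v : R) : set R -> \bar R :=
  if v == 0 then \d_m else normal_prob m (Num.sqrt v).

(* Possibly degenerate multivariate normal law N(m, S): every linear
   combination a of the coordinates has law N(a^T m, a^T S a). *)
Definition multivariate_normal (R : realType) (d : measure_display)
    (Omega : measurableType d) (P : probability Omega R) (n : nat)
    (Z : 'I_n -> Omega -> R) (m : 'cV[R]_n) (S : 'M[R]_n) : Prop :=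
  [/\ forall i, measurable_fun setT (Z i),
      S^T = S,
      forall a : 'cV[R]_n, 0 <= quad_form S a
    & forall (a : 'cV[R]_n) (A : set R), measurable A ->
        P ((fun w => \sum_i a i 0 * Z i w) @^-1` A) =
        normal_law ((a^T *m m) 0 0) (quad_form S a) A].

Definition gaussian_process (R : realType) (d : measure_display)
    (Omega : measurableType d) (P : probability Omega R) (I : Type)
    (U : I -> Omega -> R) (m : I -> R) (k : I -> I -> R) : Prop :=
  forall (n : nat) (p : 'I_n -> I),
    multivariate_normal P (fun i => U (p i))
      (\col_i m (p i)) (\matrix_(i, j) k (p i) (p j)).

Definition sq_exp_kernel (R : realType) (T : nat) (su : R) (Su : 'M[R]_T)
    (p q : T.-tuple R * T.-tuple R) : R :=
  su ^+ 2 * expR (- (1 / 2) * quad_form (invmx Su) (colv p.1 - colv q.1)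
                  - (1 / 2) * quad_form (invmx Su) (colv p.2 - colv q.2)).

Definition skew_part (R : realType) (E Omega : Type) (U : E * E -> Omega -> R)
    (x y : E) (w : Omega) : R :=
  U (x, y) w - U (y, x) w.

Definition iid3 (R : realType) (d d' : measure_display)
    (Omega : measurableType d) (E : measurableType d')
    (Q : probability Omega R) (piX : probability E R)
    (X Y W : {mfun Omega >-> E}) : Prop :=
  [/\ forall A, measurable A -> distribution Q X A = piX A,
      forall A, measurable A -> distribution Q Y A = piX A,
      forall A, measurable A -> distribution Q W A = piX A
    & forall A B C, measurable A -> measurable B -> measurable C ->
        Q (X @^-1` A `&` Y @^-1` B `&` W @^-1` C) =
        (Q (X @^-1` A) * Q (Y @^-1` B) * Q (W @^-1` C))%E].

(* The random function F lives on (Omega, P) and the attributes on (Omega', Q),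
   so that on the product space the attributes are independent of F.
   Conditioning on F then amounts to freezing w : Omega and taking the variance
   or covariance over Omega' only; E_F is the integral over Omega. *)
Definition sigma2 (R : realType) (d d' : measure_display)
    (Omega : measurableType d) (Omega' : measurableType d')
    (P : probability Omega R) (Q : probability Omega' R) (E : Type)
    (F : E -> E -> Omega -> R) (X Y : Omega' -> E) : \bar R :=
  (\int[P]_w 'V_Q[fun t => F (X t) (Y t) w])%E.

Definition shared_endpoint_cov (R : realType) (d d' : measure_display)
    (Omega : measurableType d) (Omega' : measurableType d')
    (P : probability Omega R) (Q : probability Omega' R) (E : Type)
    (F : E -> E -> Omega -> R) (X Y W : Omega' -> E) : \bar R :=
  (\int[P]_w covariance Q (fun t => F (X t) (Y t) w)
                          (fun t => F (X t) (W t) w))%E.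

Definition shared_endpoint_corr (R : realType) (d d' : measure_display)
    (Omega : measurableType d) (Omega' : measurableType d')
    (P : probability Omega R) (Q : probability Omega' R) (E : Type)
    (F : E -> E -> Omega -> R) (X Y W : Omega' -> E) : \bar R :=
  ((fine (sigma2 P Q F X Y))^-1%:E * shared_endpoint_cov P Q F X Y W)%E.

(* Main.v *)
Require Import Defs.
From HB Require Import structures.
From mathcomp Require Import all_boot all_order all_algebra.
From mathcomp Require Import all_classical all_reals all_analysis.
From mathcomp Require Import measurable_realfun ring lra.

(* With kappa(x, y) = exp(- c |x - y|^2 / 2) and c = r^2 / sx^2, the kernel of U
   is su^2 kappa(x, v) kappa(y, w), so E_P F(x, y)^2 = 2 su^2 (1 - kappa(x, y)^2)
   and, by polarisation, E_P F(x, y) F(x, w) =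
   2 su^2 (kappa(y, w) - kappa(x, y) kappa(x, w)).  Conditionally on F the mean
   of F(X, Y) vanishes by exchangeability, so Fubini reduces the variance and
   the covariance to Gaussian integrals of kappa over X, Y, W, and
     rho(r) = ((1 + 2 r^2)^(-T/2) - ((1 + r^2) (1 + 3 r^2))^(-T/2))
              / (1 - (1 + 4 r^2)^(-T/2)).
   The law of the attributes is known only through its one-dimensional
   projections, i.e. through E cos(b . (X - a)).  Writing exp(- c u^2 / 2) as the
   mean of cos(sqrt c xi u) for a standard normal xi turns these, one coordinate
   at a time, into the integrals of kappa. *)

Set Implicit Arguments.
Unset Strict Implicit.
Unset Printing Implicit Defensive.

Import Order.TTheory GRing.Theory Num.Theory.
Import numFieldNormedType.Exports HBNNSimple.

Local Open Scope classical_set_scope.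
Local Open Scope ring_scope.

(** * Gaussian integrals on the line *)

(** The shape of the asymptotic statement is dictated by T. Replacing 1 + 2 r^2 by 2 r^2 costs a
    relative error of about T / (4 r^2), hence a term of order r^-(T+2), while the other correction
    terms are of order r^-(2T). The former dominates as soon as T >= 3, so the difference from the
    leading term is O(r^-(2T)) for T <= 2 and O(r^-(2T) + r^-(T+2)) in general, whereas the
    equivalence [~_] only asks for a relative error tending to 0.

    On the probabilistic side, nothing is given about the integrability of F(X, Y) for a frozen path
    of F. Conditional means are therefore treated at the level of [fine], and integrability is
    produced only on the product space, from uniform second moments. Normal laws may be degenerate
    (for instance F(x, x) = 0), so every moment formula has a separate point-mass case. *)

(** Indicators are the hypothesis, simple functions follow by linearity over their level sets, and
    monotone convergence along [nnsfun_approx] on both sides gives the rest. It turns integrals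
    against a normal probability into Lebesgue integrals. *)
Lemma ge0_integral_density d (T : measurableType d) (R : realType)
    (mu nu : {measure set T -> \bar R}) (g : T -> R) (f : T -> \bar R) :
  measurable_fun setT g -> (forall x, 0 <= g x) ->
  (forall A, measurable A -> nu A = \int[mu]_(x in A) (g x)%:E)%E ->
  measurable_fun setT f -> (forall x, 0 <= f x)%E ->
  (\int[nu]_x f x = \int[mu]_x (f x * (g x)%:E))%E.
Proof.
move=> mg g0 nuE mf f0.
pose h := nnsfun_approx measurableT mf.
have fE x : f x = limn (fun n => (h n x)%:E).
  by apply/esym/cvg_lim => //; apply: cvg_nnsfun_approx.
have mh n : measurable_fun setT (fun x => (h n x)%:E).
  by apply/measurable_EFinP; exact/measurable_funP.
have ndh x : {homo (fun n => (h n x)%:E) : n m / (n <= m)%N >-> (n <= m)%E}.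
  by move=> a b ab; rewrite lee_fin; exact/lefP/nd_nnsfun_approx.
have mge : measurable_fun setT (EFin \o g) by exact/measurable_EFinP.
transitivity (limn (fun n => \int[nu]_x (h n x)%:E))%E.
  under eq_integral do rewrite fE.
  apply: monotone_convergence => //.
  by move=> n x _; rewrite lee_fin.
transitivity (limn (fun n => \int[mu]_x ((h n x)%:E * (g x)%:E)))%E; last first.
  apply/esym.
  have fg x : (f x * (g x)%:E = limn (fun n => (h n x)%:E * (g x)%:E))%E.
    by apply/esym/cvg_lim => //; apply: cvgeZr => //; exact: cvg_nnsfun_approx.
  under eq_integral do rewrite fg.
  apply: monotone_convergence => //.
  - by move=> n; apply: emeasurable_funM.
  - by move=> n x _; rewrite mule_ge0// lee_fin.
  - by move=> x _ a b ab; rewrite lee_wpmul2r ?lee_fin//; exact/lefP/nd_nnsfun_approx.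
congr (limn _); apply/funext => n.
have indich r : measurable_fun setT (fun x => (r * \1_(h n @^-1` [set r]) x)%:E).
  by apply/measurable_EFinP; apply: measurable_funM.
transitivity (\int[nu]_x
   (\sum_(y \in range (h n)) (y * \1_(h n @^-1` [set y]) x)%:E))%E.
  by apply: eq_integral => t tE; rewrite /= fimfunE -fsumEFin.
rewrite ge0_integral_fsum//; last by move=> m y Ey; exact: nnfun_muleindic_ge0.
transitivity (\int[mu]_x (\sum_(y \in range (h n))
    (y * \1_(h n @^-1` [set y]) x)%:E * (g x)%:E))%E; last first.
  apply: eq_integral => x xE.
  rewrite -ge0_mule_fsuml => [|y]; last exact: nnfun_muleindic_ge0.
  by rewrite fsumEFin // -(fimfunE _ x).
rewrite ge0_integral_fsum//; last 2 first.
  - by move=> y; apply: emeasurable_funM.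
  - by move=> m y Ey; apply: mule_ge0; [exact: nnfun_muleindic_ge0|rewrite lee_fin].
apply: eq_fsbigr => r rhn.
under eq_integral do rewrite EFinM.
rewrite integralZl_indic_nnsfun//.
under [RHS]eq_integral do rewrite EFinM -muleA.
have mS : measurable (h n @^-1` [set r]) by [].
rewrite ge0_integralZl//.
- congr (_ * _)%E.
  rewrite integral_indic// setIT nuE// integral_mkcond.
  by apply: eq_integral => x _; rewrite epatch_indic /= muleC.
- by apply: emeasurable_funM => //; exact/measurable_EFinP.
- by move=> t Et; rewrite mule_ge0 ?lee_fin ?g0.
- by move: rhn; rewrite inE => -[t _ <-]; rewrite lee_fin.
Qed.

(** Positive and negative parts are transferred separately, so both sides agree as extended
    differences, infinite ones included, before [fine] is taken. *)
Lemma Rintegral_density d (T : measurableType d) (R : realType)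
    (mu nu : {measure set T -> \bar R}) (g f : T -> R) :
  measurable_fun setT g -> (forall x, 0 <= g x) ->
  (forall A, measurable A -> nu A = \int[mu]_(x in A) (g x)%:E)%E ->
  measurable_fun setT f ->
  \int[nu]_x f x = \int[mu]_x (f x * g x).
Proof.
move=> mg g0 nuE mf; congr fine.
rewrite integralE [in RHS]integralE; congr (_ - _)%E.
  rewrite (ge0_integral_density mg g0 nuE)//; last first.
    by apply: measurable_funepos; exact/measurable_EFinP.
  by apply: eq_integral => x _; rewrite !funeposE /= EFinM maxe_pMl ?lee_fin// mul0e.
rewrite (ge0_integral_density mg g0 nuE)//; last first.
  by apply: measurable_funeneg; exact/measurable_EFinP.
by apply: eq_integral => x _; rewrite !funenegE /= maxe_pMl ?lee_fin// mul0e -EFinM mulNr.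
Qed.

Local Notation leb := lebesgue_measure.

(** The fundamental theorem on [-n, n] gives [f n - f (- n)], and dominated convergence with
    majorant [|f'|] passes to the whole line. *)
Lemma Rintegral_derive_eq0 (R : realType) (f f' : R -> R) :
  continuous f' -> (forall x : R, is_derive x (1:R) f (f' x)) ->
  leb.-integrable setT (EFin \o f') ->
  f n%:R @[n --> \oo] --> 0 -> f (- n%:R) @[n --> \oo] --> 0 ->
  \int[leb]_x f' x = 0.
Proof.
move=> cf' df intf' fp fm.
have mf' : measurable_fun setT f' by exact: continuous_measurable_fun.
pose g n x := (f' \_ `[- n%:R, n%:R]) x.
have [|||||_ _ cvg_int] := @dominated_convergence _ _ R leb setT measurableT
  (fun n x => (g n x)%:E) (EFin \o f') (EFin \o (Num.norm \o f')).
- move=> n; apply/measurable_EFinP.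
  apply/(measurable_restrictT f'); first by [].
  exact: measurable_funTS.
- exact/measurable_EFinP.
- apply/aeW => x _; apply: cvg_near_cst.
  near=> n; rewrite /g patchE mem_set//= in_itv/= -ler_norml.
  near: n; exact: nbhs_infty_ger.
- exact: integrable_norm.
- apply/aeW => x n _; rewrite /g patchE; case: ifP => _ /=; rewrite lee_fin//.
  by rewrite normr0.
(* Shifted by one, because the fundamental theorem is applied on a nondegenerate interval and
   [-0, 0] is a point. *)
have intE n : (\int[leb]_x (g n.+1 x)%:E = (f n.+1%:R - f (- n.+1%:R))%:E)%E.
  rewrite EFinB -(continuous_FTC2 (f := f') (F := f))//.
  - rewrite [RHS]integral_mkcond; apply: eq_integral => x _.
    by rewrite /g restrict_EFin.
  - by rewrite gtrN.
  - exact: continuous_subspaceT.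
  - split => [x _||].
    + by have [] := df x.
    + apply: cvg_at_right_filter.
      by apply: differentiable_continuous; apply/derivable1_diffP; have [] := df (- n.+1%:R).
    + apply: cvg_at_left_filter.
      by apply: differentiable_continuous; apply/derivable1_diffP; have [] := df (n.+1%:R).
  - by move=> x _; rewrite derive1E; apply: derive_val.
have : (f n.+1%:R - f (- n.+1%:R))%:E @[n --> \oo] --> (0 - 0)%:E.
  apply: cvg_EFin; first exact: nearW.
  by apply: cvgB; rewrite (cvg_shiftS (fun n => f _)).
rewrite subrr => cvg0.
move: cvg_int; rewrite -cvg_shiftS /=.
under eq_fun do rewrite intE.
move=> cvg_int; rewrite /Rintegral.
by have /= -> := cvg_unique _ cvg_int cvg0.
Unshelve. all: by end_near. Qed.

Lemma is_derive_normal_fun (R : realType) (m s x : R) :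
  is_derive x (1:R) (normal_fun m s) (- (x - m) / s ^+ 2 * normal_fun m s x).
Proof.
apply: is_derive_eq.
rewrite /GRing.scale /= /normal_fun.
(* For [s = 0] the convention 0^-1 = 0 makes [normal_fun] constant and the claimed derivative 0. *)
have [->|s0] := eqVneq s 0; first by rewrite expr0n /= mul0rn invr0; ring.
by field; exact: s0.
Qed.

(** Half of the exponent absorbs the quadratic factor: for z = (x - m)^2 / (4 s^2) the two
    exponentials are exp(-2z) and exp(-z), and 1 + 4 s^2 z <= (1 + 4 s^2) exp(z) follows from 1 + z
    <= exp(z). This supplies an integrable majorant for every function of quadratic growth. *)
Lemma normal_fun_sqrD1_le (R : realType) (m s x : R) : s != 0 ->
  (1 + (x - m) ^+ 2) * normal_fun m s x <=
  (1 + 4 * s ^+ 2) * normal_fun m (Num.sqrt 2 * s) x.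
Proof.
move=> s0; rewrite /normal_fun exprMn sqr_sqrtr//.
have s2 : 0 < s ^+ 2 by rewrite exprn_even_gt0.
set z := (x - m) ^+ 2 / (4 * s ^+ 2).
have -> : - (x - m) ^+ 2 / (s ^+ 2 *+ 2) = - z - z by rewrite /z; field.
have -> : - (x - m) ^+ 2 / (2 * s ^+ 2 *+ 2) = - z by rewrite /z; field.
have -> : (x - m) ^+ 2 = 4 * s ^+ 2 * z by rewrite /z; field.
have z0 : 0 <= z by rewrite divr_ge0 ?sqr_ge0// mulr_ge0// ltW.
rewrite expRD mulrA ler_wpM2r ?expR_ge0// expRN ler_pdivrMr ?expR_gt0//.
have := expR_ge1Dx z; nra.
Qed.

Lemma integrable_normal_fun (R : realType) (m s : R) : s != 0 ->
  leb.-integrable setT (EFin \o normal_fun m s).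
Proof.
move=> s0.
have := integrableZl measurableT (normal_peak s)^-1 (integrable_normal_pdf m s).
apply: eq_integrable => // x _ /=.
by rewrite normal_pdfE// -EFinM mulKf// gt_eqF// normal_peak_gt0.
Qed.

Lemma integrable_mul_normal_fun (R : realType) (m s B : R) (h : R -> R) :
  s != 0 -> measurable_fun setT h ->
  (forall x, `|h x| <= B * (1 + (x - m) ^+ 2)) ->
  leb.-integrable setT (EFin \o (fun x => h x * normal_fun m s x)).
Proof.
move=> s0 mh hB.
have s20 : Num.sqrt 2 * s != 0 by rewrite mulf_neq0// gt_eqF// sqrtr_gt0.
have := integrableZl measurableT (B * (1 + 4 * s ^+ 2))
  (integrable_normal_fun m s20).
apply: le_integrable => //.
  by apply/measurable_EFinP; apply: measurable_funM => //; exact: measurable_normal_fun.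
move=> x _ /=; rewrite lee_fin normrM (ger0_norm (normal_fun_ge0 _ _ _)).
rewrite [leRHS]ger0_norm.
  rewrite (le_trans (ler_wpM2r (normal_fun_ge0 _ _ _) (hB x)))//.
  rewrite -!mulrA ler_wpM2l ?normal_fun_sqrD1_le//.
  have := le_trans (normr_ge0 _) (hB x); rewrite pmulr_lge0//.
  by rewrite ltr_wpDr// sqr_ge0.
rewrite mulr_ge0 ?normal_fun_ge0// mulr_ge0//.
  have := le_trans (normr_ge0 _) (hB x); rewrite pmulr_lge0//.
  by rewrite ltr_wpDr// sqr_ge0.
by rewrite addr_ge0// mulr_ge0// sqr_ge0.
Qed.

(** Taken along any sequence with [|x n| = n], so that both ends of the line are covered at once. *)
Lemma cvg_normal_fun (R : realType) (m s : R) (x : nat -> R) : s != 0 ->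
  (forall n, `|x n| = n%:R) -> normal_fun m s (x n) @[n --> \oo] --> 0.
Proof.
move=> s0 xn.
have s2 : 0 < s ^+ 2 by rewrite exprn_even_gt0.
under eq_fun do rewrite /normal_fun mulNr.
apply: (@cvg_comp _ _ _ (fun n => (x n - m) ^+ 2 / (s ^+ 2 *+ 2))
  (fun y => expR (- y)) _ _ _ _ (@cvgr_expR R)).
apply/cvgryPge => A.
near=> n.
rewrite ler_pdivlMr ?pmulrn_lgt0//.
have : `|m| + 1 + `|A * (s ^+ 2 *+ 2)| <= n%:R.
  by near: n; exact: nbhs_infty_ger.
rewrite -xn => nbig.
have h1 : 1 + `|A * (s ^+ 2 *+ 2)| <= `|x n - m|.
  by have := lerB_dist (x n) m; lra.
rewrite -(real_normK (num_real (x n - m))).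
apply: le_trans (ler_norm _) _.
move: h1 (normr_ge0 (A * (s ^+ 2 *+ 2))).
move: `|x n - m| `|A * _| => y c h1 c0.
nra.
Unshelve. all: by end_near. Qed.

(** The difference of the two sides is the integral of the derivative of [u * normal_fun m s], which
    vanishes at both ends; the growth bounds also make each integrand integrable. *)
Lemma normal_fun_stein (R : realType) (m s B : R) (u u' : R -> R) :
  s != 0 -> (forall x : R, is_derive x (1:R) u (u' x)) -> continuous u' ->
  (forall x, `|u x| <= B * (1 + `|x - m|)) ->
  (forall x, `|u' x| <= B * (1 + (x - m) ^+ 2)) ->
  \int[leb]_x (u' x * normal_fun m s x) =
  s ^- 2 * \int[leb]_x ((u x * (x - m)) * normal_fun m s x).
Proof.
move=> s0 du cu' uB u'B.
have cu : continuous u.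
  move=> x; apply: differentiable_continuous; apply/derivable1_diffP.
  by have [] := du x.
have B0 : 0 <= B.
  have := le_trans (normr_ge0 _) (uB 0); rewrite pmulr_lge0; [exact|by rewrite ltr_wpDr].
have abs_sqr x : 1 + `|x - m| <= 2 * (1 + (x - m) ^+ 2).
  rewrite -(real_normK (num_real (x - m))); nra.
have mux : measurable_fun setT (fun x => u x * (x - m)).
  by apply: measurable_funM; [exact: continuous_measurable_fun|exact: measurable_funB].
have i1 : leb.-integrable setT (EFin \o (fun x => u' x * normal_fun m s x)).
  by apply: integrable_mul_normal_fun => //; exact: continuous_measurable_fun.
have i2 : leb.-integrable setT (EFin \o (fun x => (u x * (x - m)) * normal_fun m s x)).
  apply: (@integrable_mul_normal_fun _ _ _ (2 * B)) => // x.
  rewrite normrM (le_trans (ler_wpM2r (normr_ge0 _) (uB x)))//.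
  rewrite -(real_normK (num_real (x - m))) -subr_ge0.
  rewrite [leRHS](_ : _ = B * (2 * (1 + `|x - m| ^+ 2) - (1 + `|x - m|) * `|x - m|)); last by ring.
  by rewrite mulr_ge0//; nra.
rewrite -RintegralZl//; apply/eqP; rewrite -subr_eq0 -RintegralB//; last first.
  by have := integrableZl measurableT (s ^- 2) i2; apply: eq_integrable.
apply/eqP.
have cp : continuous (normal_fun m s).
  move=> x; apply: differentiable_continuous; apply/derivable1_diffP.
  by have [] := is_derive_normal_fun m s x.
(* The wider Gaussian, of standard deviation sqrt 2 * s, absorbs the linear growth of [u] and still
   tends to 0. *)
have key : forall x : nat -> R, (forall n, `|x n| = n%:R) ->
    (u (x n) * normal_fun m s (x n)) @[n --> \oo] --> 0.
  move=> x xn.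
  apply/norm_cvg0P.
  have s20 : Num.sqrt 2 * s != 0 by rewrite mulf_neq0// gt_eqF// sqrtr_gt0.
  apply: (@squeeze_cvgr _ _ _ _ (fun=> 0)
    (fun n => (2 * B * (1 + 4 * s ^+ 2)) * normal_fun m (Num.sqrt 2 * s) (x n))).
  - apply: nearW => n; rewrite normr_ge0/= normrM (ger0_norm (normal_fun_ge0 _ _ _)).
    rewrite (le_trans (ler_wpM2r (normal_fun_ge0 _ _ _) (uB _)))//.
    rewrite (mulrC 2) -!mulrA ler_wpM2l//.
    apply: le_trans (ler_wpM2l _ (normal_fun_sqrD1_le _ _ _)) => //.
    by rewrite mulrA ler_wpM2r ?normal_fun_ge0.
  - exact: cvg_cst.
  - rewrite -[X in _ --> X](mulr0 (2 * B * (1 + 4 * s ^+ 2))).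
    by apply: cvgM; [exact: cvg_cst|exact: cvg_normal_fun].
apply: (@Rintegral_derive_eq0 _ (fun x => u x * normal_fun m s x)).
- move=> x; apply: cvgB; first by apply: cvgM; [exact: cu'|exact: cp].
  apply: cvgM; first exact: cvg_cst.
  apply: cvgM; last exact: cp.
  by apply: cvgM; [exact: cu|apply: cvgB; [exact: cvg_id|exact: cvg_cst]].
- move=> x.
  have dp := is_derive_normal_fun m s x.
  apply: is_derive_eq.
  by rewrite /GRing.scale /=; ring.
- have := integrableB measurableT i1 (integrableZl measurableT (s ^- 2) i2).
  by apply: eq_integrable.
- by apply: key => n; rewrite normr_nat.
- by apply: (key (fun n => - n%:R)) => n; rewrite normrN normr_nat.
Qed.

(** Differentiation under the integral sign on a unit neighbourhood of [t]. Since [f'] is bounded by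
    1 and |y| <= 1 + y^2, the majorant [G] does not depend on [t]. *)
Lemma is_derive_Rintegral_normal_fun (R : realType) (m s t : R) (f f' : R -> R) :
  s != 0 -> (forall x : R, is_derive x (1:R) f (f' x)) -> continuous f' ->
  (forall x, `|f x| <= 1) -> (forall x, `|f' x| <= 1) ->
  is_derive t (1:R) (fun t => \int[leb]_x (f (t * (x - m)) * normal_fun m s x))
    (\int[leb]_x (f' (t * (x - m)) * (x - m) * normal_fun m s x)).
Proof.
move=> s0 df cf' fB f'B.
have cf : continuous f.
  move=> x; apply: differentiable_continuous; apply/derivable1_diffP.
  by have [] := df x.
have mlin (c : R) : measurable_fun setT (fun x : R => c * (x - m)).
  by apply: measurable_funM => //; exact: measurable_funB.
pose F (t x : R) := f (t * (x - m)) * normal_fun m s x.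
have dF (c x : R) : is_derive c (1:R) (F ^~ x) (f' (c * (x - m)) * (x - m) * normal_fun m s x).
  have dfc := df (c * (x - m)).
  apply: is_derive_eq.
  by rewrite /GRing.scale /=; ring.
have pF c x : partial1of2 F c x = f' (c * (x - m)) * (x - m) * normal_fun m s x.
  by rewrite /partial1of2 derive1E; exact: derive_val.
pose G x := (1 + (x - m) ^+ 2) * normal_fun m s x.
have G0 x : 0 <= G x by rewrite mulr_ge0 ?normal_fun_ge0// addr_ge0// sqr_ge0.
have intG : leb.-integrable setT (EFin \o G).
  apply: (@integrable_mul_normal_fun _ _ _ 1) => //.
    by apply: measurable_funD => //; apply: measurable_funX; exact: measurable_funB.
  by move=> x; rewrite mul1r ger0_norm// addr_ge0// sqr_ge0.
have intF (x : R) : `]t - 1, t + 1[%classic x -> leb.-integrable setT (EFin \o F x).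
  move=> _; apply: (@integrable_mul_normal_fun _ _ _ 1) => //.
    by apply: measurableT_comp; [exact: continuous_measurable_fun|exact: mlin].
  by move=> y; rewrite mul1r (le_trans (fB _))// lerDl sqr_ge0.
have derF (x y : R) : `]t - 1, t + 1[%classic x -> setT y -> derivable (F ^~ y) x 1.
  by move=> _ _; have [] := dF x y.
have GB (x y : R) : `]t - 1, t + 1[%classic x -> setT y -> `|partial1of2 F x y| <= G y.
  move=> _ _; rewrite pF normrM (ger0_norm (normal_fun_ge0 _ _ _)) /G.
  rewrite ler_wpM2r ?normal_fun_ge0// normrM.
  rewrite (le_trans (ler_wpM2r (normr_ge0 _) (f'B _)))//.
  by rewrite -(real_normK (num_real (y - m))); nra.
have tI : `]t - 1, t + 1[%classic t by rewrite /= in_itv/= ltrBlDr ltrDl ltr01.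
have -> : (\int[leb]_x (f' (t * (x - m)) * (x - m) * normal_fun m s x)) =
  'D_1 (fun t => \int[leb]_x F t x) t.
  rewrite -derive1E (differentiation_under_integral measurableT tI intF derF G0 intG GB).
  by apply: eq_Rintegral => x _; rewrite pF.
apply: derivableP.
exact: (derivable_under_integral measurableT tI intF derF G0 intG GB).
Qed.

Lemma Rintegral_normal_fun (R : realType) (m s : R) : s != 0 ->
  \int[leb]_x normal_fun m s x = (normal_peak s)^-1.
Proof.
move=> s0; have p0 := normal_peak_gt0 s0.
have : \int[leb]_x (normal_peak s * normal_fun m s x) = 1.
  rewrite /Rintegral -[RHS]/(fine 1%E) -(integral_normal_pdf m s).
  by congr fine; apply: eq_integral => x _; rewrite normal_pdfE.
rewrite RintegralZl//; last exact: integrable_normal_fun.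
by move=> h; apply: (mulfI (lt0r_neq0 p0)); rewrite h divff// gt_eqF.
Qed.

Lemma Rintegral_normal_prob (R : realType) (m s : R) (f : R -> R) :
  s != 0 -> measurable_fun setT f ->
  leb.-integrable setT (EFin \o (fun x => f x * normal_fun m s x)) ->
  \int[normal_prob m s]_x f x = normal_peak s * \int[leb]_x (f x * normal_fun m s x).
Proof.
move=> s0 mf intf.
rewrite (@Rintegral_density _ _ _ leb _ (normal_pdf m s))//.
- rewrite -RintegralZl//; apply: eq_Rintegral => x _.
  by rewrite normal_pdfE// mulrCA.
- exact: measurable_normal_pdf.
- exact: normal_pdf_ge0.
Qed.

Section normal_prob_integrals.
Variables (R : realType) (m s : R).
Hypothesis s0 : s != 0.
Let p := normal_fun m s.
Let mB : measurable_fun setT (fun x : R => x - m). Proof. exact: measurable_funB. Qed.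

(** Stein's identity with [u] constant equal to 1. *)
Lemma Rintegral_normal_prob_center : \int[normal_prob m s]_x (x - m) = 0.
Proof.
rewrite Rintegral_normal_prob//; last first.
  apply: (@integrable_mul_normal_fun _ _ _ 1) => // x.
  by rewrite mul1r -(real_normK (num_real (x - m))); nra.
have d1 (x : R) : is_derive x (1:R) (cst (1:R)) (0:R) by exact: is_derive_cst.
have c0 : continuous (cst 0 : R -> R) by move=> x; exact: cvg_cst.
have h1 (x : R) : `|cst (1:R) x| <= 1 * (1 + `|x - m|) by rewrite /= normr1 mul1r lerDl.
have h2 (x : R) : `|cst (0:R) x| <= 1 * (1 + (x - m) ^+ 2).
  by rewrite /= normr0 mul1r addr_ge0 ?sqr_ge0.
have := normal_fun_stein s0 d1 c0 h1 h2.
under eq_Rintegral do rewrite /= mul0r.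
rewrite Rintegral_cst// mul0r.
under eq_Rintegral do rewrite /= mul1r.
move/esym/eqP; rewrite mulf_eq0 invr_eq0 expf_eq0 /= (negbTE s0) /= => /eqP ->.
by rewrite mulr0.
Qed.

(** Stein's identity with [u x = x - m], together with the total mass. *)
Lemma Rintegral_normal_prob_center_sqr :
  \int[normal_prob m s]_x ((x - m) ^+ 2) = s ^+ 2.
Proof.
rewrite Rintegral_normal_prob//; last 2 first.
  by apply: measurable_funX.
  apply: (@integrable_mul_normal_fun _ _ _ 1) => //; first exact: measurable_funX.
  by move=> x; rewrite mul1r ger0_norm ?sqr_ge0// lerDr.
have dx (x : R) : is_derive x (1:R) (fun x => x - m) 1.
  by apply: is_derive_eq; rewrite subr0.
have c1 : continuous (cst 1 : R -> R) by move=> x; exact: cvg_cst.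
have h1 (x : R) : `|x - m| <= 1 * (1 + `|x - m|) by rewrite mul1r lerDr.
have h2 (x : R) : `|cst (1:R) x| <= 1 * (1 + (x - m) ^+ 2).
  by rewrite /= normr1 mul1r lerDl sqr_ge0.
have := normal_fun_stein s0 dx c1 h1 h2.
under eq_Rintegral do rewrite /= mul1r.
rewrite Rintegral_normal_fun//.
under eq_Rintegral do rewrite /= -expr2.
have p0 : normal_peak s != 0 by rewrite gt_eqF// normal_peak_gt0.
move=> h; rewrite -[RHS]mul1r -(mulfV p0) h.
by field; rewrite ?p0 ?s0.
Qed.

(* By the Stein identity the integral solves [y' = - s^2 t y] as a function of [t]. *)
Lemma Rintegral_normal_fun_osc (g f : R -> R) t :
  (forall x : R, is_derive x (1:R) g (f x)) ->
  (forall x : R, is_derive x (1:R) f (- g x)) ->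
  (forall x, `|g x| <= 1) -> (forall x, `|f x| <= 1) ->
  \int[leb]_x (g (t * (x - m)) * p x) =
  g 0 * expR (- (s ^+ 2 * t ^+ 2) / 2) / normal_peak s.
Proof.
move=> dg df gB fB.
have dcont (h h' : R -> R) : (forall x : R, is_derive x (1:R) h (h' x)) -> continuous h.
  move=> dh x; apply: differentiable_continuous; apply/derivable1_diffP.
  by have [] := dh x.
have cg := dcont _ _ dg; have cf := dcont _ _ df.
have mlin (c : R) : measurable_fun setT (fun x : R => c * (x - m)).
  exact: measurable_funM.
have intg c : leb.-integrable setT (EFin \o (fun x => g (c * (x - m)) * p x)).
  apply: (@integrable_mul_normal_fun _ _ _ 1) => //.
    by apply: measurableT_comp; [exact: continuous_measurable_fun|exact: mlin].
  by move=> y; rewrite mul1r (le_trans (gB _))// lerDl sqr_ge0.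
pose I c := \int[leb]_x (g (c * (x - m)) * p x).
have stein c : \int[leb]_x (f (c * (x - m)) * (x - m) * p x) = - (s ^+ 2 * c * I c).
  have du (x : R) : is_derive x (1:R) (fun x => f (c * (x - m))) (- c * g (c * (x - m))).
    have dfc := df (c * (x - m)).
    by apply: is_derive_eq; rewrite /GRing.scale /=; ring.
  have cu' : continuous (fun x => - c * g (c * (x - m))).
    move=> x; apply: cvgM; first exact: cvg_cst.
    apply: (@cvg_comp _ _ _ (fun x => c * (x - m)) g _ (nbhs (c * (x - m)))).
      by apply: cvgM; [exact: cvg_cst|apply: cvgB; [exact: cvg_id|exact: cvg_cst]].
    exact: cg.
  have uB x : `|f (c * (x - m))| <= (1 + `|c|) * (1 + `|x - m|).
    rewrite (le_trans (fB _))//; have := normr_ge0 c; have := normr_ge0 (x - m); nra.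
  have u'B x : `|- c * g (c * (x - m))| <= (1 + `|c|) * (1 + (x - m) ^+ 2).
    rewrite normrM normrN (le_trans (ler_wpM2l (normr_ge0 _) (gB _)))// mulr1.
    have := normr_ge0 c; have := sqr_ge0 (x - m); nra.
  have := normal_fun_stein s0 du cu' uB u'B.
  rewrite -/p.
  have -> : \int[leb]_x (- c * g (c * (x - m)) * p x) = - c * I c.
    by rewrite -RintegralZl//; apply: eq_Rintegral => x _; rewrite mulrA.
  move/(congr1 ( *%R (s ^+ 2))); rewrite mulVKf ?expf_neq0// => <-.
  by ring.
have dI (c : R) : is_derive c (1:R) I (- (s ^+ 2 * c * I c)).
  by rewrite -stein; exact: is_derive_Rintegral_normal_fun.
(* The integrating factor exp(s^2 c^2 / 2) makes the product constant, hence equal to its value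
   [I 0] at frequency 0. *)
have dJ (c : R) : is_derive c (1:R) (fun c => I c * expR ((s ^+ 2 * c ^+ 2) / 2)) 0.
  have dIc := dI c.
  by apply: is_derive_eq; rewrite /GRing.scale /=; field.
have := is_derive_0_is_cst t 0 dJ.
rewrite expr0n /= mulr0 mul0r expR0 mulr1.
have -> : I 0 = g 0 / normal_peak s.
  rewrite -(Rintegral_normal_fun m s0) -RintegralZl//; last exact: integrable_normal_fun.
  by apply: eq_Rintegral => x _; rewrite mul0r.
move=> h; rewrite -/(I t) mulNr expRN mulrAC -h mulfK//.
by rewrite gt_eqF// expR_gt0.
Qed.

Lemma Rintegral_normal_prob_cos t :
  \int[normal_prob m s]_x cos (t * (x - m)) = expR (- (s ^+ 2 * t ^+ 2) / 2).
Proof.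
have p0 : normal_peak s != 0 by rewrite gt_eqF// normal_peak_gt0.
have mcos : measurable_fun setT (fun x : R => cos (t * (x - m))).
  apply: measurableT_comp; last exact: measurable_funM.
  by apply: continuous_measurable_fun; exact: continuous_cos.
rewrite Rintegral_normal_prob//; last first.
  apply: (@integrable_mul_normal_fun _ _ _ 1) => // x.
  by rewrite mul1r (le_trans (cos_max _))// lerDl sqr_ge0.
rewrite (@Rintegral_normal_fun_osc _ (fun x => - sin x)).
- by rewrite cos0 mul1r mulrCA mulfV// mulr1.
- by move=> x; exact: cos_max.
- by move=> x; rewrite normrN; exact: sin_max.
Qed.

Lemma Rintegral_normal_prob_sin t :
  \int[normal_prob m s]_x sin (t * (x - m)) = 0.
Proof.
have msin : measurable_fun setT (fun x : R => sin (t * (x - m))).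
  apply: measurableT_comp; last exact: measurable_funM.
  by apply: continuous_measurable_fun; exact: continuous_sin.
rewrite Rintegral_normal_prob//; last first.
  apply: (@integrable_mul_normal_fun _ _ _ 1) => // x.
  by rewrite mul1r (le_trans (sin_max _))// lerDl sqr_ge0.
rewrite (@Rintegral_normal_fun_osc _ cos).
- by rewrite sin0 !mul0r mulr0.
- by move=> x; exact: sin_max.
- by move=> x; exact: cos_max.
Qed.

End normal_prob_integrals.

(** * Random variables with a normal law *)

(** Nonnegative functions go through the pushforward measure; treating positive and negative parts
    separately extends the equality to every measurable [f], integrable or not. *)
Lemma integral_comp d d' (T : measurableType d) (T' : measurableType d')
    (R : realType) (P : {measure set T -> \bar R}) (nu : {measure set T' -> \bar R})
    (Z : T -> T') (f : T' -> \bar R) :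
  measurable_fun setT Z ->
  (forall A, measurable A -> P (Z @^-1` A) = nu A) ->
  measurable_fun setT f ->
  (\int[P]_w f (Z w) = \int[nu]_x f x)%E.
Proof.
move=> mZ PZ mf.
have ge0 (g : T' -> \bar R) : measurable_fun setT g -> (forall x, 0 <= g x)%E ->
    (\int[P]_w g (Z w) = \int[nu]_x g x)%E.
  move=> mg g0.
  transitivity (\int[pushforward P Z]_x g x)%E.
    by rewrite ge0_integral_pushforward.
  by apply: eq_measure_integral => A mA _; rewrite /= -PZ.
rewrite integralE [RHS]integralE.
rewrite -(ge0 (f^\+)%E)//; last exact: measurable_funepos.
rewrite -(ge0 (f^\-)%E)//; last exact: measurable_funeneg.
by congr (_ - _)%E; apply: eq_integral => x _; rewrite ?funeposE ?funenegE.
Qed.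

Lemma Rintegral_probability_cst d (T : measurableType d) (R : realType)
    (P : probability T R) (r : R) : \int[P]_x r = r.
Proof.
transitivity (r * fine (P setT)); first exact: Rintegral_cst.
by rewrite probability_setT mulr1.
Qed.

Section normal_law.
Variables (R : realType) (d : measure_display) (Omega : measurableType d).
Variables (P : probability Omega R) (Z : Omega -> R) (m v : R).
Hypothesis mZ : measurable_fun setT Z.
Hypothesis PZ : forall A, measurable A -> P (Z @^-1` A) = normal_law m v A.

(** A point mass integrates everything; for [v != 0] the integral is compared with the Lebesgue
    integral of a function of quadratic growth against the Gaussian. *)
Lemma integrable_normal_law (B : R) (f : R -> R) :
  0 <= v -> measurable_fun setT f ->
  (forall x, `|f x| <= B * (1 + (x - m) ^+ 2)) ->
  P.-integrable setT (EFin \o (f \o Z)).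
Proof.
move=> v0 mf fB; apply/integrableP; split.
  by apply/measurable_EFinP; exact: measurableT_comp.
have mnf : measurable_fun setT (fun x => `|(f x)%:E|)%E.
  by apply: measurableT_comp => //; exact/measurable_EFinP.
move: PZ; rewrite /normal_law; case: eqP => [v_eq0|/eqP v_neq0] PZ'.
  rewrite (integral_comp (nu := \d_m) mZ PZ' mnf)//.
  by rewrite integral_dirac// diracT mul1e ltry.
rewrite (integral_comp (nu := normal_prob m (Num.sqrt v)) mZ PZ' mnf)//.
have s0 : Num.sqrt v != 0 by rewrite gt_eqF// sqrtr_gt0 lt_neqAle eq_sym v_neq0.
rewrite (ge0_integral_density (mu := leb) (nu := normal_prob m (Num.sqrt v))
  (measurable_normal_pdf m (Num.sqrt v))
  (normal_pdf_ge0 m (Num.sqrt v)) (fun A _ => erefl _))//.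
have := integrableZl measurableT (normal_peak (Num.sqrt v))
  (integrable_mul_normal_fun s0 mf fB).
case/integrableP => _; apply: le_lt_trans.
rewrite le_eqVlt; apply/orP; left; apply/eqP.
apply: eq_integral => x _ /=; rewrite normal_pdfE// -!EFinM !normrM.
rewrite (ger0_norm (normal_fun_ge0 _ _ _)) (ger0_norm (normal_peak_ge0 _)).
by rewrite mulrCA.
Qed.

Lemma Rintegral_normal_law (f : R -> R) : measurable_fun setT f ->
  \int[P]_w f (Z w) =
  if v == 0 then f m else \int[normal_prob m (Num.sqrt v)]_x f x.
Proof.
move=> mf.
have mef : measurable_fun setT (EFin \o f) by exact/measurable_EFinP.
move: PZ; rewrite /normal_law; case: eqP => [_|_] PZ'; rewrite /Rintegral.
  rewrite (integral_comp (nu := \d_m) mZ PZ' mef)//.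
  by rewrite integral_dirac// diracT mul1e.
by rewrite (integral_comp (nu := normal_prob m (Num.sqrt v)) mZ PZ' mef).
Qed.

Lemma Rintegral_normal_law_center : 0 <= v -> \int[P]_w (Z w - m) = 0.
Proof.
move=> v0; rewrite (Rintegral_normal_law (f := fun x => x - m)); last first.
  exact: measurable_funB.
case: eqP => [_|/eqP v_neq0]; first by rewrite subrr.
apply: Rintegral_normal_prob_center.
by rewrite gt_eqF// sqrtr_gt0 lt_neqAle eq_sym v_neq0.
Qed.

Lemma Rintegral_normal_law_center_sqr : 0 <= v -> \int[P]_w ((Z w - m) ^+ 2) = v.
Proof.
move=> v0; rewrite (Rintegral_normal_law (f := fun x => (x - m) ^+ 2)); last first.
  by apply: measurable_funX; exact: measurable_funB.
case: eqP => [->|/eqP v_neq0]; first by rewrite subrr expr0n.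
rewrite Rintegral_normal_prob_center_sqr ?sqr_sqrtr//.
by rewrite gt_eqF// sqrtr_gt0 lt_neqAle eq_sym v_neq0.
Qed.

Lemma Rintegral_normal_law_cos :
  0 <= v -> \int[P]_w cos (Z w - m) = expR (- v / 2).
Proof.
move=> v0; rewrite (Rintegral_normal_law (f := fun x => cos (x - m))); last first.
  apply: measurableT_comp; last exact: measurable_funB.
  by apply: continuous_measurable_fun; exact: continuous_cos.
case: eqP => [->|/eqP v_neq0]; first by rewrite subrr cos0 oppr0 mul0r expR0.
have s0 : Num.sqrt v != 0 by rewrite gt_eqF// sqrtr_gt0 lt_neqAle eq_sym v_neq0.
have := Rintegral_normal_prob_cos m s0 1.
by under eq_Rintegral do rewrite mul1r; rewrite sqr_sqrtr// expr1n mulr1.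
Qed.

Lemma Rintegral_normal_law_sin : 0 <= v -> \int[P]_w sin (Z w - m) = 0.
Proof.
move=> v0; rewrite (Rintegral_normal_law (f := fun x => sin (x - m))); last first.
  apply: measurableT_comp; last exact: measurable_funB.
  by apply: continuous_measurable_fun; exact: continuous_sin.
case: eqP => [_|/eqP v_neq0]; first by rewrite subrr sin0.
have s0 : Num.sqrt v != 0 by rewrite gt_eqF// sqrtr_gt0 lt_neqAle eq_sym v_neq0.
have := Rintegral_normal_prob_sin m s0 1.
by under eq_Rintegral do rewrite mul1r.
Qed.

(** The centred real integral only determines [fine] of the expectation; integrability of [Z] is
    what lifts the value to the extended reals. *)
Lemma normal_law_expectation : 0 <= v -> ('E_P[Z] = m%:E)%E.
Proof.
move=> v0.
have iZ : P.-integrable setT (EFin \o (id \o Z)).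
  apply: (@integrable_normal_law (1 + `|m|)) => // x.
  rewrite -(real_normK (num_real (x - m))).
  have := ler_normD (x - m) m; rewrite subrK.
  have := sqr_ge0 (`|x - m| - 1); have := mulr_ge0 (normr_ge0 m) (sqr_ge0 `|x - m|).
  by rewrite /=; have := normr_ge0 (x - m); lra.
have := Rintegral_normal_law_center v0.
rewrite RintegralB//; last exact: finite_measure_integrable_cst.
rewrite Rintegral_probability_cst => /subr0_eq <-.
by rewrite unlock /Rintegral fineK//; exact: integrable_fin_num iZ.
Qed.

Lemma integral_normal_law_center_sqr : 0 <= v ->
  P.-integrable setT (EFin \o (fun w => (Z w - m) ^+ 2)) /\
  (\int[P]_w ((Z w - m) ^+ 2)%:E = v%:E)%E.
Proof.
move=> v0.
have i2 : P.-integrable setT (EFin \o ((fun x => (x - m) ^+ 2) \o Z)).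
  apply: (@integrable_normal_law 1) => //.
    by apply: measurable_funX; exact: measurable_funB.
  by move=> x; rewrite mul1r ger0_norm ?sqr_ge0// lerDr.
split => //.
rewrite -[in RHS](Rintegral_normal_law_center_sqr v0).
by rewrite /Rintegral fineK//; exact: integrable_fin_num i2.
Qed.

End normal_law.

Lemma integrable_bounded d (T : measurableType d) (R : realType)
    (P : {finite_measure set T -> \bar R}) (f : T -> R) (M : R) :
  measurable_fun setT f -> (forall x, `|f x| <= M) ->
  P.-integrable setT (EFin \o f).
Proof.
move=> mf fM; apply: (@le_integrable _ _ _ P setT _ _ (EFin \o cst M)) => //.
- exact/measurable_EFinP.
- by move=> x _ /=; rewrite lee_fin (le_trans (fM x))// ler_norm.
- exact: finite_measure_integrable_cst.
Qed.

Lemma Rintegral_bounded_fubini d1 d2 (T1 : measurableType d1)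
    (T2 : measurableType d2) (R : realType) (P : probability T1 R)
    (Q : probability T2 R) (f : T1 * T2 -> R) (M : R) :
  measurable_fun setT f -> (forall x, `|f x| <= M) ->
  \int[P]_x \int[Q]_y f (x, y) = \int[Q]_y \int[P]_x f (x, y).
Proof.
move=> mf fM; rewrite /Rintegral.
have i1 x : Q.-integrable setT (fun y => (f (x, y))%:E).
  by apply: integrable_bounded (fun y => fM (x, y)); exact: measurableT_comp.
have i2 y : P.-integrable setT (fun x => (f (x, y))%:E).
  by apply: integrable_bounded (fun x => fM (x, y)); exact: measurableT_comp.
under eq_integral do rewrite fineK ?(integrable_fin_num _ (i1 _))//.
under [in RHS]eq_integral do rewrite fineK ?(integrable_fin_num _ (i2 _))//.
congr fine; apply: (Fubini (f := EFin \o f)).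
apply/integrable12ltyP; first exact/measurable_EFinP.
apply: (@le_lt_trans _ _ (\int[P]_x M%:E)%E); last first.
  rewrite integral_cst// (le_lt_trans (lee_wpmul2l _ (probability_le1 P _)))//.
    by rewrite lee_fin (le_trans (normr_ge0 _) (fM point)).
  by rewrite mule1 ltry.
apply: ge0_le_integral => //.
- by move=> x _; exact: integral_ge0.
- apply: (measurable_fun_fubini_tonelli_F (fun z => `|(f z)%:E|)%E) => //.
  by apply: measurableT_comp => //; exact/measurable_EFinP.
- move=> x _; rewrite -[leRHS]mule1 -(probability_setT Q) -integral_cst//.
  apply: ge0_le_integral => //.
  + apply: measurableT_comp => //; apply/measurable_EFinP; exact: measurableT_comp.
  + by move=> y _; rewrite lee_fin fM.
Qed.

(** The factor exp(- v x^2 / 2) merges with the standard density into that of variance 1 / (1 + v),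
    and the ratio of the normalising constants is (1 + v)^(-1/2). The phase [e] is split off by the
    addition formula, where the sine term integrates to 0. *)
Lemma Rintegral_std_normal_gauss_cos (R : realType) (t e v : R) : 0 <= v ->
  \int[normal_prob 0 1]_x (cos (t * x + e) * expR (- (v * x ^+ 2) / 2)) =
  cos e * ((Num.sqrt (1 + v))^-1 * expR (- (t ^+ 2 / (1 + v)) / 2)).
Proof.
move=> v0.
have v1 : 0 < 1 + v by rewrite ltr_wpDr.
set s : R := (Num.sqrt (1 + v))^-1.
have s_gt0 : 0 < s by rewrite invr_gt0 sqrtr_gt0.
have s0 : s != 0 by rewrite gt_eqF.
have s2 : s ^+ 2 = (1 + v)^-1 by rewrite exprVn sqr_sqrtr// ltW.
have mlin (c : R) : measurable_fun setT (fun x : R => c * x) by exact: measurable_funM.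
have mcos : measurable_fun setT (fun x : R => cos (t * x + e)).
  apply: measurableT_comp; last exact: measurable_funD.
  by apply: continuous_measurable_fun; exact: continuous_cos.
have mexp : measurable_fun setT (fun x : R => expR (- (v * x ^+ 2) / 2)).
  apply: measurableT_comp => //; apply: measurable_funM => //.
  by apply: measurableT_comp => //; apply: measurable_funM => //; exact: measurable_funX.
have nE (x : R) : expR (- (v * x ^+ 2) / 2) * normal_fun 0 1 x = normal_fun 0 s x.
  rewrite /normal_fun -expRD; congr expR; rewrite s2 subr0 expr1n.
  by field; exact: lt0r_neq0.
rewrite Rintegral_normal_prob//; last 2 first.
- exact: measurable_funM.
- apply: (@integrable_mul_normal_fun _ _ _ 1); first by rewrite oner_eq0.
    exact: measurable_funM.
  move=> x; rewrite mul1r subr0 (@le_trans _ _ 1)//; last by rewrite lerDl sqr_ge0.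
  rewrite normrM -[leRHS]mulr1 ler_pM ?cos_max//.
  rewrite ger0_norm ?expR_ge0// -expR0 ler_expR.
  by rewrite mulNr oppr_le0 divr_ge0// mulr_ge0// sqr_ge0.
under eq_Rintegral do rewrite -mulrA nE.
have ntriv (f : R -> R) : measurable_fun setT f -> (forall x, `|f x| <= 1) ->
    leb.-integrable setT (EFin \o (fun x => f x * normal_fun 0 s x)).
  move=> mf fB; apply: (@integrable_mul_normal_fun _ _ _ 1) => // x.
  by rewrite mul1r (le_trans (fB x))// lerDl sqr_ge0.
have -> : \int[leb]_x (cos (t * x + e) * normal_fun 0 s x) =
    (normal_peak s)^-1 * \int[normal_prob 0 s]_x cos (t * x + e).
  rewrite Rintegral_normal_prob//; last by apply: ntriv => // x; exact: cos_max.
  by rewrite mulKf// gt_eqF// normal_peak_gt0.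
have -> : \int[normal_prob 0 s]_x cos (t * x + e) = cos e * expR (- (t ^+ 2 / (1 + v)) / 2).
  have mc : measurable_fun setT (fun x : R => cos (t * (x - 0))).
    apply: measurableT_comp; last by apply: measurable_funM => //; exact: measurable_funB.
    by apply: continuous_measurable_fun; exact: continuous_cos.
  have ms : measurable_fun setT (fun x : R => sin (t * (x - 0))).
    apply: measurableT_comp; last by apply: measurable_funM => //; exact: measurable_funB.
    by apply: continuous_measurable_fun; exact: continuous_sin.
  transitivity (\int[normal_prob 0 s]_x (cos e * cos (t * (x - 0)) - sin e * sin (t * (x - 0)))).
    by apply: eq_Rintegral => x _; rewrite subr0 cosD; ring.
  have ic := integrable_bounded (normal_prob 0 s) mc (fun x => cos_max _).
  have isi := integrable_bounded (normal_prob 0 s) ms (fun x => sin_max _).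
  rewrite RintegralB//; last 2 first.
  - exact: (integrableZl measurableT (cos e) ic).
  - exact: (integrableZl measurableT (sin e) isi).
  rewrite !RintegralZl// Rintegral_normal_prob_cos// Rintegral_normal_prob_sin//.
  by rewrite mulr0 subr0 s2 [(1 + v)^-1 * _]mulrC.
have -> : normal_peak (1:R) = s * normal_peak s.
  rewrite /normal_peak expr1n mul1r s2 -invfM -sqrtrM; last exact: ltW.
  congr (Num.sqrt _)^-1; field; exact: lt0r_neq0.
by field; rewrite ?gt_eqF// normal_peak_gt0.
Qed.

(** * Isotropic Gaussian vectors *)

Lemma quad_form_scalar (R : realType) T (c : R) (a : 'cV[R]_T) :
  quad_form c%:M a = c * \sum_i a i 0 ^+ 2.
Proof.
rewrite /quad_form mul_mx_scalar -scalemxAl !mxE; congr (_ * _).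
by apply: eq_bigr => i _; rewrite !mxE expr2.
Qed.

Section isotropic_normal.
Variables (R : realType) (T : nat) (piX : probability (T.-tuple R) R).
Variables (s : R) (m : 'cV[R]_T).
Hypothesis piN : multivariate_normal piX (fun i x => tnth x i) m ((s ^+ 2)%:M).

(** The linear form with coefficients [b] is normal with variance s^2 |b|^2. Its deterministic
    offset [e] is separated by the addition formula, and the centred sine integrates to 0. *)
Lemma Rintegral_isotropic_normal_cos (a b : 'I_T -> R) :
  \int[piX]_x cos (\sum_i b i * (tnth x i - a i)) =
  cos (\sum_i b i * (m i 0 - a i)) * expR (- (s ^+ 2 * \sum_i b i ^+ 2) / 2).
Proof.
case: piN => _ _ S0 lawE.
pose Z (x : T.-tuple R) := \sum_i (\col_i b i) i 0 * tnth x i.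
have mZ : measurable_fun setT Z.
  apply: measurable_sum => i; apply: measurable_funM => //.
  exact: measurable_tnth.
have ZE := lawE (\col_i b i); have v0 := S0 (\col_i b i).
have mE : ((\col_i b i)^T *m m) 0 0 = \sum_i b i * m i 0.
  by rewrite mxE; apply: eq_bigr => i _; rewrite !mxE.
have vE : quad_form (s ^+ 2)%:M (\col_i b i) = s ^+ 2 * \sum_i b i ^+ 2.
  by rewrite quad_form_scalar; congr (_ * _); apply: eq_bigr => i _; rewrite mxE.
have hc := Rintegral_normal_law_cos mZ ZE v0.
have hs := Rintegral_normal_law_sin mZ ZE v0.
rewrite mE in hc hs.
rewrite vE in hc.
pose e := \sum_i b i * (m i 0 - a i).
pose Y x := Z x - \sum_i b i * m i 0.
have YE x : \sum_i b i * (tnth x i - a i) = Y x + e.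
  rewrite /Y /e /Z -sumrB -big_split /=; apply: eq_bigr => i _.
  by rewrite !mxE; ring.
have mY : measurable_fun setT Y by exact: measurable_funB.
have mc : measurable_fun setT (fun x => cos (Y x)).
  by apply: measurableT_comp => //; apply: continuous_measurable_fun; exact: continuous_cos.
have ms : measurable_fun setT (fun x => sin (Y x)).
  by apply: measurableT_comp => //; apply: continuous_measurable_fun; exact: continuous_sin.
have ic := integrable_bounded piX mc (fun x => cos_max _).
have isi := integrable_bounded piX ms (fun x => sin_max _).
transitivity (\int[piX]_x (cos e * cos (Y x) - sin e * sin (Y x))).
  by apply: eq_Rintegral => x _; rewrite YE cosD; ring.
rewrite RintegralB//; last 2 first.
- exact: (integrableZl measurableT (cos e) ic).
- exact: (integrableZl measurableT (sin e) isi).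
by rewrite !RintegralZl// hc hs mulr0 subr0.
Qed.

Variables (c : R) (a : 'I_T -> R).
Hypothesis c0 : 0 <= c.

(** This is E exp(- c (Z - a_i)^2 / 2) for a normal Z with mean [m i 0] and variance s^2. *)
Let kappa i := (Num.sqrt (1 + s ^+ 2 * c))^-1 *
  expR (- (c / (1 + s ^+ 2 * c) * (m i 0 - a i) ^+ 2) / 2).

(* Coordinates are moved one at a time from the cosine into the product, by
   exp(-c u^2/2) = E cos(sqrt c xi u) for xi standard normal. *)
Lemma Rintegral_isotropic_normal_mixed (S : {set 'I_T}) (b : 'I_T -> R) :
  \int[piX]_x (\prod_(i in S) expR (- (c * (tnth x i - a i) ^+ 2) / 2) *
               cos (\sum_(i in ~: S) b i * (tnth x i - a i))) =
  \prod_(i in S) kappa i * (cos (\sum_(i in ~: S) b i * (m i 0 - a i)) *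
    expR (- (s ^+ 2 * \sum_(i in ~: S) b i ^+ 2) / 2)).
Proof.
have [n] := ubnP #|S|; elim: n S b => // n IH S b.
have [->|[i0 i0S]] := set_0Vmem S.
  have sumT (h : 'I_T -> R) : \sum_(i in [set: 'I_T]%SET) h i = \sum_i h i.
    by apply: eq_bigl => i; rewrite finset.in_setT.
  move=> _; rewrite big_set0 finset.setC0 mul1r !sumT -Rintegral_isotropic_normal_cos.
  by apply: eq_Rintegral => x _; rewrite big_set0 mul1r sumT.
rewrite (cardsD1 i0) i0S add1n ltnS => Sn.
have CS : ~: (S :\ i0) = i0 |: ~: S.
  by apply/setP => i; rewrite !inE; case: eqP => //= _; rewrite negbK.
have i0CS : i0 \notin ~: S by rewrite inE negbK.
(* Taking [i0] out of [S] puts it under the cosine with the random frequency sqrt c * xi; averaging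
   over [xi] restores its Gaussian factor. *)
pose b' xi i := if i == i0 then Num.sqrt c * xi else b i.
have sumb' xi (g : R -> R) (h : 'I_T -> R) :
    \sum_(i in ~: (S :\ i0)) g (b' xi i) * h i =
    g (Num.sqrt c * xi) * h i0 + \sum_(i in ~: S) g (b i) * h i.
  rewrite CS big_setU1//= /b' eqxx; congr (_ + _).
  apply: eq_bigr => i iS; case: eqP => // ii0.
  by move: i0CS; rewrite -ii0 iS.
pose A (x : T.-tuple R) := \prod_(i in S :\ i0) expR (- (c * (tnth x i - a i) ^+ 2) / 2).
pose V (x : T.-tuple R) := \sum_(i in ~: S) b i * (tnth x i - a i).
pose f (z : T.-tuple R * R) :=
  A z.1 * cos (Num.sqrt c * (tnth z.1 i0 - a i0) * z.2 + V z.1).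
have exp_le1 (y : R) : expR (- (c * y ^+ 2) / 2) <= 1.
  by rewrite -expR0 ler_expR mulNr oppr_le0 divr_ge0// mulr_ge0// sqr_ge0.
have A01 x : 0 <= A x <= 1.
  apply/andP; split; first by apply: prodr_ge0 => i _; exact: expR_ge0.
  by apply: prodr_ile1 => i _; rewrite expR_ge0 exp_le1.
have mtn i : measurable_fun setT (fun z : T.-tuple R * R => tnth z.1 i - a i).
  apply: measurable_funB => //.
  by apply: (measurableT_comp (measurable_tnth i)); exact: measurable_fst.
have mf : measurable_fun setT f.
  apply: measurable_funM.
    rewrite /A; under eq_fun do rewrite -big_filter.
    apply: measurable_prod => i _; apply: measurableT_comp => //.
    apply: measurable_funM => //; apply: measurableT_comp => //.
    by apply: measurable_funM => //; exact: measurable_funX.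
  apply: measurableT_comp; first by apply: continuous_measurable_fun; exact: continuous_cos.
  apply: measurable_funD.
    by apply: measurable_funM => //; exact: measurable_funM.
  rewrite /V; under eq_fun do rewrite -big_filter.
  by apply: measurable_sum => i; exact: measurable_funM.
have fB z : `|f z| <= 1.
  have /andP[A0 A1] := A01 z.1.
  by rewrite /f normrM (ger0_norm A0) mulr_ile1// cos_max.
transitivity (\int[piX]_x \int[normal_prob 0 1]_xi f (x, xi)).
  apply: eq_Rintegral => x _.
  rewrite (big_setD1 i0)//= -/(A x) -/(V x).
  (* With [v = 0] this is the cosine moment of a standard normal, the other coordinates [V x] acting
     as the phase. *)
  have := Rintegral_std_normal_gauss_cos (Num.sqrt c * (tnth x i0 - a i0)) (V x) (lexx 0).
  rewrite addr0 sqrtr1 invr1 mul1r. rewrite mulr1 exprMn sqr_sqrtr//.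
  under eq_Rintegral do rewrite mul0r oppr0 mul0r expR0 mulr1.
  move=> h; rewrite /f /= RintegralZl//; first by rewrite h; ring.
  apply: (integrable_bounded _ _ (fun x => cos_max _)).
  apply: measurableT_comp; first by apply: continuous_measurable_fun; exact: continuous_cos.
  by apply: measurable_funD => //; exact: measurable_funM.
rewrite (Rintegral_bounded_fubini piX (normal_prob 0 1) mf fB).
transitivity (\int[normal_prob 0 1]_xi
  (\prod_(i in S :\ i0) kappa i * expR (- (s ^+ 2 * \sum_(i in ~: S) b i ^+ 2) / 2) *
   (cos (Num.sqrt c * (m i0 0 - a i0) * xi + \sum_(i in ~: S) b i * (m i 0 - a i)) *
   expR (- (s ^+ 2 * c * xi ^+ 2) / 2)))).
  apply: eq_Rintegral => xi _.
  transitivity (\int[piX]_x (\prod_(i in S :\ i0) expR (- (c * (tnth x i - a i) ^+ 2) / 2) *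
      cos (\sum_(i in ~: (S :\ i0)) b' xi i * (tnth x i - a i)))).
    apply: eq_Rintegral => x _; rewrite (sumb' xi id (fun i => tnth x i - a i)) /f /=.
    by rewrite mulrAC.
  rewrite IH// (sumb' xi id (fun i => m i 0 - a i)) /=.
  have -> : \sum_(i in ~: (S :\ i0)) b' xi i ^+ 2 = c * xi ^+ 2 + \sum_(i in ~: S) b i ^+ 2.
    have := sumb' xi (fun y => y ^+ 2) (fun=> 1).
    rewrite mulr1 exprMn sqr_sqrtr// => h.
    transitivity (\sum_(i in ~: (S :\ i0)) b' xi i ^+ 2 * 1).
      by apply: eq_bigr => i _; rewrite mulr1.
    by rewrite h; congr (_ + _); apply: eq_bigr => i _; rewrite mulr1.
  rewrite -!mulrA; congr (_ * _).
  rewrite [RHS]mulrCA [Num.sqrt c * (xi * _)]mulrCA [xi * (_ * _)]mulrC -[in RHS]expRD.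
  congr (cos (_ + _) * expR _); [by rewrite mulrA|by field].
rewrite RintegralZl//; last first.
  have cs0 : 0 <= s ^+ 2 * c by rewrite mulr_ge0// sqr_ge0.
  apply: (@integrable_bounded _ _ _ _ _ 1); last first.
    move=> xi; rewrite normrM mulr_ile1// ?cos_max//.
    rewrite ger0_norm ?expR_ge0// -expR0 ler_expR mulNr oppr_le0.
    by rewrite divr_ge0// mulr_ge0// sqr_ge0.
  apply: measurable_funM.
    apply: measurableT_comp; first by apply: continuous_measurable_fun; exact: continuous_cos.
    by apply: measurable_funD => //; exact: measurable_funM.
  apply: measurableT_comp => //; apply: measurable_funM => //.
  by apply: measurableT_comp => //; apply: measurable_funM => //; exact: measurable_funX.
(* The frequency at [i0] left a factor exp(- s^2 c xi^2 / 2), so the formula is used with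
   [v = s^2 c] and yields exactly [kappa i0]. *)
rewrite Rintegral_std_normal_gauss_cos; last by rewrite mulr_ge0// sqr_ge0.
rewrite [in RHS](big_setD1 i0)//= (_ : kappa i0 = (Num.sqrt (1 + s ^+ 2 * c))^-1 *
  expR (- ((Num.sqrt c * (m i0 0 - a i0)) ^+ 2 / (1 + s ^+ 2 * c)) / 2)); first by ring.
by rewrite /kappa exprMn sqr_sqrtr// [c * _ / _]mulrAC.
Qed.
End isotropic_normal.

(** * Joint laws of independent attributes *)

Section iid_laws.
Variables (R : realType) (d d' : measure_display).
Variables (Omega : measurableType d) (E : measurableType d').
Variables (Q : probability Omega R) (piX : probability E R).

Let pi2 : subprobability (E * E)%type R :=
  product_subprobability ((piX : subprobability E R), (piX : subprobability E R)).

Lemma pair_law (X Y : Omega -> E) :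
  measurable_fun setT X -> measurable_fun setT Y ->
  (forall A B, measurable A -> measurable B ->
    Q (X @^-1` A `&` Y @^-1` B) = (piX A * piX B)%E) ->
  forall M, measurable M -> Q ((fun t => (X t, Y t)) @^-1` M) = pi2 M.
Proof.
move=> mX mY h M mM.
have mXY : measurable_fun setT (fun t => (X t, Y t)) by exact: measurable_fun_pair.
pose XY : {mfun Omega >-> (E * E)%type} := mfun_Sub (mem_set mXY).
by apply/esym; apply: (@product_measure_unique _ _ E E R piX piX (distribution Q XY)).
Qed.

(** Uniqueness of product measures is used twice, because a measurable set [B] of E * E need not be
    a rectangle. For fixed [A], the finite measure B -> Q(X in A, (Y, W) in B) is identified on
    rectangles as the product of [piX] with [piX] scaled by [piX A]; this gives the law on the sets
    A * B. *)
Lemma triple_law (X Y W : Omega -> E) :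
  measurable_fun setT X -> measurable_fun setT Y -> measurable_fun setT W ->
  (forall A B C, measurable A -> measurable B -> measurable C ->
    Q (X @^-1` A `&` Y @^-1` B `&` W @^-1` C) = (piX A * piX B * piX C)%E) ->
  forall M, measurable M ->
    Q ((fun t => (X t, (Y t, W t))) @^-1` M) = (piX \x pi2)%E M.
Proof.
move=> mX mY mW h M mM.
have mYW : measurable_fun setT (fun t => (Y t, W t)) by exact: measurable_fun_pair.
have mXYW : measurable_fun setT (fun t => (X t, (Y t, W t))) by exact: measurable_fun_pair.
pose XYW : {mfun Omega >-> (E * (E * E))%type} := mfun_Sub (mem_set mXYW).
apply/esym.
apply: (@product_measure_unique _ _ E (E * E)%type R piX pi2 (distribution Q XYW)) => // A B mA mB.
have mXA : measurable (X @^-1` A) by rewrite -[X in measurable X]setTI; exact: mX.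
have k0 : 0 <= fine (piX A) by rewrite fine_ge0.
have kE : ((NngNum k0)%:num%:E = piX A)%E by rewrite /= fineK// fin_num_measure.
pose pik := mscale (NngNum k0) piX.
have pikE C : pik C = (piX A * piX C)%E.
  by transitivity ((NngNum k0)%:num%:E * piX C)%E => //; rewrite kE.
pose YW : {mfun Omega >-> (E * E)%type} := mfun_Sub (mem_set mYW).
have H := @product_measure_unique _ _ E E R piX pik
  (pushforward (mrestr Q mXA) YW).
transitivity ((piX \x pik)%E B).
  rewrite H//.
    by rewrite /pushforward /mrestr /distribution /=; congr (Q _);
      apply/seteqP; split => t /= [].
  move=> B1 B2 mB1 mB2.
  transitivity (piX B1 * (piX A * piX B2))%E; last by congr (_ * _)%E; apply/esym; exact: pikE.
  rewrite muleCA muleA -h// /pushforward /mrestr; congr (Q _).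
  by apply/seteqP; split => t /=; tauto.
transitivity (\int[piX]_x (piX A * piX (xsection B x)))%E.
  by apply: eq_integral => x _; exact: pikE.
rewrite ge0_integralZl//.
exact: measurable_fun_xsection.
Qed.

Lemma Rintegral_pair_law (X Y : Omega -> E) (f : E * E -> R) (M : R) :
  measurable_fun setT X -> measurable_fun setT Y ->
  (forall A B, measurable A -> measurable B ->
    Q (X @^-1` A `&` Y @^-1` B) = (piX A * piX B)%E) ->
  measurable_fun setT f -> (forall x, `|f x| <= M) ->
  \int[Q]_t f (X t, Y t) = \int[piX]_x \int[piX]_y f (x, y).
Proof.
move=> mX mY h mf fM.
have mXY : measurable_fun setT (fun t => (X t, Y t)) by exact: measurable_fun_pair.
have mef : measurable_fun setT (EFin \o f) by exact/measurable_EFinP.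
rewrite /Rintegral (integral_comp mXY (pair_law mX mY h) mef).
have i1 x : piX.-integrable setT (fun y => (f (x, y))%:E).
  by apply: integrable_bounded (fun y => fM (x, y)); exact: measurableT_comp.
under [in RHS]eq_integral do rewrite fineK ?(integrable_fin_num _ (i1 _))//.
congr fine; rewrite (integral12_prod_meas1 (f := EFin \o f))//.
exact: (integrable_bounded pi2 mf fM).
Qed.

Lemma Rintegral_triple_law (X Y W : Omega -> E) (f : E * (E * E) -> R) (M : R) :
  measurable_fun setT X -> measurable_fun setT Y -> measurable_fun setT W ->
  (forall A B C, measurable A -> measurable B -> measurable C ->
    Q (X @^-1` A `&` Y @^-1` B `&` W @^-1` C) = (piX A * piX B * piX C)%E) ->
  measurable_fun setT f -> (forall x, `|f x| <= M) ->
  \int[Q]_t f (X t, (Y t, W t)) =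
  \int[piX]_x \int[piX]_y \int[piX]_w f (x, (y, w)).
Proof.
move=> mX mY mW h mf fM.
have mXYW : measurable_fun setT (fun t => (X t, (Y t, W t))).
  by apply: measurable_fun_pair => //; exact: measurable_fun_pair.
have mef : measurable_fun setT (EFin \o f) by exact/measurable_EFinP.
rewrite /Rintegral (integral_comp mXYW (triple_law mX mY mW h) mef).
have mx x : measurable_fun setT (fun z : E * E => f (x, z)) by exact: measurableT_comp.
have i1 x y : piX.-integrable setT (fun w => (f (x, (y, w)))%:E).
  by apply: integrable_bounded (fun w => fM (x, (y, w))); exact: (measurableT_comp (mx x)).
have i2 x : pi2.-integrable setT (fun z => (f (x, z))%:E).
  by apply: integrable_bounded (fun z => fM (x, z)).
have fub x : (\int[pi2]_z (f (x, z))%:E = \int[piX]_y \int[piX]_w (f (x, (y, w)))%:E)%E.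
  by rewrite -(integral12_prod_meas1 (f := fun z => (f (x, z))%:E)).
under [in RHS]eq_integral => x _.
  under eq_integral do rewrite fineK ?(integrable_fin_num _ (i1 _ _))//.
  rewrite -fub fineK ?(integrable_fin_num _ (i2 _))//.
  over.
congr fine; rewrite -(integral12_prod_meas1 (f := EFin \o f))//.
pose pi3 : subprobability (E * (E * E))%type R :=
  product_subprobability ((piX : subprobability E R), pi2).
exact: (integrable_bounded pi3 mf fM).
Qed.
End iid_laws.

(** * Integrals of the squared exponential kernel *)

Lemma sumr_sqr_distC (R : realType) T (a b : 'I_T -> R) :
  \sum_i (a i - b i) ^+ 2 = \sum_i (b i - a i) ^+ 2.
Proof. by apply: eq_bigr => i _; rewrite -sqrrN opprB. Qed.

(** The kernel kappa with parameter [c]. The centre is a function on indices, so that it can be the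
    coordinates of a tuple as well as those of the mean vector. *)
Definition gauss_dist (R : realType) (T : nat) (c : R) (a : 'I_T -> R)
    (x : T.-tuple R) : R :=
  expR (- (c * \sum_i (tnth x i - a i) ^+ 2) / 2).

Lemma gauss_dist_ge0 (R : realType) T (c : R) (a : 'I_T -> R) x : 0 <= gauss_dist c a x.
Proof. exact: expR_ge0. Qed.

Lemma gauss_dist_le1 (R : realType) T (c : R) (a : 'I_T -> R) x :
  0 <= c -> gauss_dist c a x <= 1.
Proof.
move=> c0; rewrite -expR0 ler_expR mulNr oppr_le0 divr_ge0// mulr_ge0// sumr_ge0//.
by move=> i _; rewrite sqr_ge0.
Qed.

Lemma normr_gauss_dist_le1 (R : realType) T (c : R) (a : 'I_T -> R) x :
  0 <= c -> `|gauss_dist c a x| <= 1.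
Proof. by move=> c0; rewrite ger0_norm ?gauss_dist_ge0// gauss_dist_le1. Qed.

Lemma measurable_gauss_dist (R : realType) T (c : R) d (Y : measurableType d)
    (x y : Y -> T.-tuple R) :
  measurable_fun setT x -> measurable_fun setT y ->
  measurable_fun setT (fun w => gauss_dist c (tnth (y w)) (x w)).
Proof.
move=> mx my; apply: measurableT_comp => //; apply: measurable_funM => //.
apply: measurableT_comp => //; apply: measurable_funM => //.
apply: measurable_sum => i; apply: measurable_funX; apply: measurable_funB.
  exact: (measurableT_comp (measurable_tnth i)).
exact: (measurableT_comp (measurable_tnth i)).
Qed.

Section isotropic_normal_kernel.
Variables (R : realType) (T : nat) (piX : probability (T.-tuple R) R).
Variables (s : R) (m : 'cV[R]_T).
Hypothesis piN : multivariate_normal piX (fun i x => tnth x i) m ((s ^+ 2)%:M).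

(** The mixed formula with [S] the full index set: every coordinate sits in the product and the
    cosine is cos 0 = 1. *)
Lemma Rintegral_isotropic_normal_gauss (c : R) (a : 'I_T -> R) : 0 <= c ->
  \int[piX]_x gauss_dist c a x = (Num.sqrt (1 + s ^+ 2 * c)) ^- T *
    expR (- (c / (1 + s ^+ 2 * c) * \sum_i (m i 0 - a i) ^+ 2) / 2).
Proof.
move=> c0; have := Rintegral_isotropic_normal_mixed piN a c0 [set: 'I_T]%SET (fun=> 0).
rewrite finset.setCT !big_set0 cos0 mulr0 oppr0 mul0r expR0 !mulr1.
have prodT (h : 'I_T -> R) : \prod_(i in [set: 'I_T]%SET) h i = \prod_i h i.
  by apply: eq_bigl => i; rewrite finset.in_setT.
rewrite prodT big_split /= prodr_const card_ord exprVn.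
have expS (h : 'I_T -> R) (e : R) : \prod_i expR (- (e * h i) / 2) = expR (- (e * \sum_i h i) / 2).
  rewrite -expR_sum; congr expR; rewrite mulr_sumr -sumrN mulr_suml.
  by apply: eq_bigr.
rewrite expS => <-; apply: eq_Rintegral => x _.
by rewrite prodT expS big_set0 cos0 mulr1.
Qed.

Let tuple_mean : T.-tuple R := [tuple m i 0 | i < T].
Let tnth_mean : tnth tuple_mean = fun i => m i 0.
Proof. by apply/funext => i; rewrite tnth_mktuple. Qed.

Variables (d : measure_display) (Omega : measurableType d).
Variables (Q : probability Omega R) (X Y W : Omega -> T.-tuple R).
Hypothesis mX : measurable_fun setT X.
Hypothesis mY : measurable_fun setT Y.
Hypothesis mW : measurable_fun setT W.

Lemma Rintegral_gauss_kernel (c : R) (x : T.-tuple R) : 0 <= c ->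
  \int[piX]_y gauss_dist c (tnth y) x = (Num.sqrt (1 + s ^+ 2 * c)) ^- T *
    gauss_dist (c / (1 + s ^+ 2 * c)) (fun i => m i 0) x.
Proof.
move=> c0; rewrite /gauss_dist sumr_sqr_distC -Rintegral_isotropic_normal_gauss//.
by apply: eq_Rintegral => y _; rewrite /gauss_dist sumr_sqr_distC.
Qed.

Lemma Rintegral_gauss_mean (c : R) : 0 <= c ->
  \int[piX]_x gauss_dist c (fun i => m i 0) x = (Num.sqrt (1 + s ^+ 2 * c)) ^- T.
Proof.
move=> c0; rewrite Rintegral_isotropic_normal_gauss// big1.
  by rewrite mulr0 oppr0 mul0r expR0 mulr1.
by move=> i _; rewrite subrr expr0n.
Qed.

(** Integrating over Y leaves a kernel centred at the mean with parameter c' = c / (1 + s^2 c); the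
    two normalisations combine by (1 + s^2 c) (1 + s^2 c') = 1 + 2 s^2 c. *)
Lemma Rintegral_gauss_pair (c : R) : 0 <= c ->
  (forall A B, measurable A -> measurable B ->
    Q (X @^-1` A `&` Y @^-1` B) = (piX A * piX B)%E) ->
  \int[Q]_t gauss_dist c (tnth (Y t)) (X t) = (Num.sqrt (1 + 2 * (s ^+ 2 * c))) ^- T.
Proof.
move=> c0 h.
have sc0 : 0 <= s ^+ 2 * c by rewrite mulr_ge0// sqr_ge0.
have sc1 : 0 < 1 + s ^+ 2 * c by rewrite ltr_wpDr.
have c'0 : 0 <= c / (1 + s ^+ 2 * c) by rewrite divr_ge0// ltW.
rewrite (Rintegral_pair_law (f := fun z => gauss_dist c (tnth z.2) z.1)
  (M := 1) mX mY h); last 2 first.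
- exact: measurable_gauss_dist.
- by move=> z; exact: normr_gauss_dist_le1.
under eq_Rintegral do rewrite /= Rintegral_gauss_kernel//.
rewrite RintegralZl//; last first.
  apply: (integrable_bounded _ _ (fun x => normr_gauss_dist_le1 _ _ _)) => //.
  by rewrite -tnth_mean; exact: measurable_gauss_dist.
rewrite Rintegral_gauss_mean// -invfM -exprMn -sqrtrM; last exact: ltW.
by congr (Num.sqrt _ ^- T); field; exact: lt0r_neq0.
Qed.

(** For fixed X the factors integrate separately, each to a centred kernel with parameter c' = c /
    (1 + s^2 c). Their product has parameter 2 c', and (1 + s^2 c)^2 (1 + 2 s^2 c') = (1 + s^2 c) (1
    + 3 s^2 c). *)
Lemma Rintegral_gauss_triple (c : R) : 0 <= c ->
  (forall A B C, measurable A -> measurable B -> measurable C ->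
    Q (X @^-1` A `&` Y @^-1` B `&` W @^-1` C) = (piX A * piX B * piX C)%E) ->
  \int[Q]_t (gauss_dist c (tnth (Y t)) (X t) * gauss_dist c (tnth (W t)) (X t)) =
  (Num.sqrt ((1 + s ^+ 2 * c) * (1 + 3 * (s ^+ 2 * c)))) ^- T.
Proof.
move=> c0 h.
have sc0 : 0 <= s ^+ 2 * c by rewrite mulr_ge0// sqr_ge0.
have sc1 : 0 < 1 + s ^+ 2 * c by rewrite ltr_wpDr.
have c'0 : 0 <= c / (1 + s ^+ 2 * c) by rewrite divr_ge0// ltW.
have c2'0 : 0 <= 2 * (c / (1 + s ^+ 2 * c)) by rewrite mulr_ge0.
rewrite (Rintegral_triple_law (f := fun z => gauss_dist c (tnth z.2.1) z.1 *
  gauss_dist c (tnth z.2.2) z.1) (M := 1) mX mY mW h); last 2 first.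
- apply: measurable_funM; apply: measurable_gauss_dist => //.
    exact: (measurableT_comp measurable_fst measurable_snd).
  exact: (measurableT_comp measurable_snd measurable_snd).
- by move=> z; rewrite normrM mulr_ile1// normr_gauss_dist_le1.
have ik x : piX.-integrable setT (EFin \o (fun y : T.-tuple R => gauss_dist c (tnth y) x)).
  apply: (integrable_bounded _ _ (fun x => normr_gauss_dist_le1 _ _ _)) => //.
  exact: measurable_gauss_dist.
transitivity (\int[piX]_x ((Num.sqrt (1 + s ^+ 2 * c)) ^- T * (Num.sqrt (1 + s ^+ 2 * c)) ^- T *
   gauss_dist (2 * (c / (1 + s ^+ 2 * c))) (fun i => m i 0) x)).
  apply: eq_Rintegral => x _ /=.
  under eq_Rintegral do rewrite RintegralZl// Rintegral_gauss_kernel//.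
  rewrite RintegralZr// Rintegral_gauss_kernel//.
  rewrite mulrACA; congr (_ * _); rewrite /gauss_dist -expRD; congr expR.
  by field; exact: lt0r_neq0.
rewrite RintegralZl//; last first.
  apply: (integrable_bounded _ _ (fun x => normr_gauss_dist_le1 _ _ _)) => //.
  by rewrite -tnth_mean; exact: measurable_gauss_dist.
rewrite Rintegral_gauss_mean// -!invfM -!exprMn -sqrtrM; last exact: ltW.
rewrite -sqrtrM; last by rewrite mulr_ge0 ?ltW.
congr (Num.sqrt _ ^- T); field; exact: lt0r_neq0.
Qed.

End isotropic_normal_kernel.

(** * Moments of the skew-symmetric function *)

Lemma quad_formE (R : realType) (n : nat) (M : 'M[R]_n) (z : 'cV[R]_n) :
  quad_form M z = \sum_j \sum_i z i 0 * M i j * z j 0.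
Proof.
rewrite /quad_form mxE; apply: eq_bigr => j _; rewrite mxE mulr_suml.
by apply: eq_bigr => i _; rewrite mxE.
Qed.

Section skew_moments.
Variables (R : realType) (d : measure_display) (Omega : measurableType d).
Variables (P : probability Omega R) (E : Type).
Variables (U : E * E -> Omega -> R) (m : E * E -> R) (k : E * E -> E * E -> R).
Variables (v : R) (kappa : E -> E -> R).
Hypothesis kE : forall p q, k p q = v * (kappa p.1 q.1 * kappa p.2 q.2).
Hypothesis kappaC : forall x y, kappa x y = kappa y x.
Hypothesis kappaxx : forall x, kappa x x = 1.
Hypothesis UG : gaussian_process P U m k.
Hypothesis EF0 : forall x y, ('E_P[skew_part U x y] = 0)%E.

Let F := skew_part U.

Lemma measurable_skew_part x y : measurable_fun setT (F x y).
Proof.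
have mU p : measurable_fun setT (U p).
  by have [mp _ _ _] := UG (fun _ : 'I_1 => p); exact: (mp ord0).
by apply: measurable_funB; exact: mU.
Qed.

(** [m] may be nonzero, but F(x, y) is normal with mean m(x, y) - m(y, x), which the centring of F
    forces to be 0. *)
Lemma skew_mean x y : m (x, y) = m (y, x).
Proof.
have [mU S0 vge0 law] := UG (fun i : 'I_2 => nth (x, y) [:: (x, y); (y, x)] i).
pose a : 'cV[R]_2 := \col_i [:: 1; -1]`_i.
have ZE w : \sum_(i < 2) a i 0 * U (nth (x, y) [:: (x, y); (y, x)] i) w = F x y w.
  by rewrite !big_ord_recl big_ord0 !mxE /= mul1r mulN1r addr0.
have := law a; rewrite (_ : (fun w => _) = F x y); last exact/funext/ZE.
move=> /(normal_law_expectation (measurable_skew_part x y))/(_ (vge0 a)).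
rewrite EF0 => -[] /esym; rewrite mxE !big_ord_recl big_ord0 !mxE /= mul1r mulN1r addr0.
exact: subr0_eq.
Qed.

(** The sum is the combination of four values of the process with coefficients 1, -1, e, -e, so its
    second moment is a quadratic form in the kernel. Since laws are known only for linear
    combinations, products are reached through squares: [e = 0] gives the variance, [e = 1] and
    [e = -1] the polarisation identity, where integrability allows the subtraction. *)
Lemma integral_skew_sqr (e : R) x y w :
  let V := v * (2 * (1 - kappa x y ^+ 2) + 4 * e * (kappa y w - kappa x y * kappa x w)
                + 2 * e ^+ 2 * (1 - kappa x w ^+ 2)) in
  P.-integrable setT (EFin \o (fun o => (F x y o + e * F x w o) ^+ 2)) /\
  (\int[P]_o ((F x y o + e * F x w o) ^+ 2)%:E = V%:E)%E.
Proof.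
move=> V.
pose p (i : 'I_4) := nth (x, y) [:: (x, y); (y, x); (x, w); (w, x)] i.
have [mU S0 vge0 law] := UG p.
pose a : 'cV[R]_4 := \col_i [:: 1; -1; e; - e]`_i.
have mG : measurable_fun setT (fun o => F x y o + e * F x w o).
  by apply: measurable_funD; [|apply: measurable_funM]; rewrite //; exact: measurable_skew_part.
have ZE o : \sum_(i < 4) a i 0 * U (p i) o = F x y o + e * F x w o.
  by rewrite !big_ord_recl big_ord0 !mxE /p /F /skew_part /=; ring.
have := law a; rewrite (_ : (fun o => _) = fun o => F x y o + e * F x w o); last exact/funext/ZE.
move=> lawG; have := integral_normal_law_center_sqr mG lawG (vge0 a).
have -> : (a^T *m (\col_i m (p i))) 0 0 = 0.
  rewrite mxE !big_ord_recl big_ord0 !mxE /p /= (skew_mean y x) (skew_mean w x).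
  by ring.
have -> : quad_form (\matrix_(i, j) k (p i) (p j)) a = V.
  rewrite quad_formE !big_ord_recl !big_ord0 !mxE /p /= !kE /= !kappaxx.
  rewrite (kappaC y x) (kappaC w x) (kappaC w y) /V; ring.
by under eq_fun do rewrite subr0; under eq_integral do rewrite subr0.
Qed.

Lemma integral_skew_sqr1 x y :
  (\int[P]_o (F x y o ^+ 2)%:E = (2 * v * (1 - kappa x y ^+ 2))%:E)%E.
Proof.
have [_] := integral_skew_sqr 0 x y y.
under eq_integral do rewrite mul0r addr0.
by move=> ->; congr (_%:E); ring.
Qed.

Lemma integral_skew_mul x y w :
  (\int[P]_o (F x y o * F x w o)%:E =
    (2 * v * (kappa y w - kappa x y * kappa x w))%:E)%E.
Proof.
have [ip Ep] := integral_skew_sqr 1 x y w.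
have [im Em] := integral_skew_sqr (-1) x y w.
transitivity (\int[P]_o (4^-1%:E * (((F x y o + 1 * F x w o) ^+ 2)%:E -
   ((F x y o + -1 * F x w o) ^+ 2)%:E)))%E.
  by apply: eq_integral => o _; rewrite -EFinB -EFinM; congr (_%:E); field.
rewrite integralZl//; last exact: (integrableB measurableT ip im).
rewrite integralB// Ep Em -EFinB -EFinM; congr (_%:E); by field.
Qed.

End skew_moments.

(** * Conditional variance and covariance as iterated integrals *)

Section random_skew_function.
Variables (R : realType) (d d' d'' : measure_display).
Variables (Omega : measurableType d) (Omega' : measurableType d').
Variables (E : measurableType d'').
Variables (P : probability Omega R) (Q : probability Omega' R).
Variables (piX : probability E R) (F : E -> E -> Omega -> R).
Hypothesis mF : measurable_fun setT (fun q : (E * E) * Omega => F q.1.1 q.1.2 q.2).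
Hypothesis FN : forall x y w, F y x w = - F x y w.

Lemma measurable_skew_comp (X Y : Omega' -> E) :
  measurable_fun setT X -> measurable_fun setT Y ->
  measurable_fun setT (fun q : Omega * Omega' => F (X q.2) (Y q.2) q.1).
Proof.
move=> mX mY.
apply: (@measurableT_comp _ _ _ _ _ _ (fun q : (E * E) * Omega => F q.1.1 q.1.2 q.2)
  _ (fun q : Omega * Omega' => ((X q.2, Y q.2), q.1))) => //.
apply: measurable_fun_pair; last exact: measurable_fst.
by apply: measurable_fun_pair; exact: (measurableT_comp _ measurable_snd).
Qed.

(* The positive and negative parts of the integrand have the same integral by
   exchangeability; if both are infinite the library's [+oo - +oo] is [-oo],
   whose [fine] is again 0. *)
Lemma fine_expectation_skew (X Y : Omega' -> E) (w : Omega) :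
  measurable_fun setT X -> measurable_fun setT Y ->
  (forall A B, measurable A -> measurable B ->
    Q (X @^-1` A `&` Y @^-1` B) = (piX A * piX B)%E) ->
  fine ('E_Q[fun t => F (X t) (Y t) w])%E = 0.
Proof.
move=> mX mY h.
have hC A B : measurable A -> measurable B ->
    Q (Y @^-1` A `&` X @^-1` B) = (piX A * piX B)%E.
  by move=> mA mB; rewrite setIC h// muleC.
have mXY : measurable_fun setT (fun t => (X t, Y t)) by exact: measurable_fun_pair.
have mYX : measurable_fun setT (fun t => (Y t, X t)) by exact: measurable_fun_pair.
pose g (z : E * E) := (F z.1 z.2 w)%:E.
have mg : measurable_fun setT g.
  apply/measurable_EFinP.
  apply: (@measurableT_comp _ _ _ _ _ _ (fun q : (E * E) * Omega => F q.1.1 q.1.2 q.2)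
    _ (fun z : E * E => (z, w))) => //.
have mgp : measurable_fun setT (g^\+)%E by exact: measurable_funepos.
rewrite unlock integralE.
have -> : (\int[Q]_t ((fun t => (F (X t) (Y t) w)%:E)^\+ t) =
           \int[Q]_t ((fun t => (F (X t) (Y t) w)%:E)^\- t))%E.
  transitivity (\int[Q]_t (g^\+ (X t, Y t)))%E.
    by apply: eq_integral => t _; rewrite !funeposE.
  rewrite (integral_comp mXY (pair_law mX mY h) mgp).
  rewrite -(integral_comp mYX (pair_law mY mX hC) mgp).
  apply: eq_integral => t _; rewrite funeposE funenegE /g /=.
  by rewrite (FN (X t) (Y t)) EFinN.
by case: (\int[Q]_t _)%E => //= r; rewrite subrr.
Qed.

(** The centring constants of [covariance] enter through [fine], so they vanish for every [w], even
    where the conditional mean is undefined. *)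
Lemma covariance_skew (X Y W : Omega' -> E) (w : Omega) :
  measurable_fun setT X -> measurable_fun setT Y -> measurable_fun setT W ->
  (forall A B, measurable A -> measurable B ->
    Q (X @^-1` A `&` Y @^-1` B) = (piX A * piX B)%E) ->
  (forall A B, measurable A -> measurable B ->
    Q (X @^-1` A `&` W @^-1` B) = (piX A * piX B)%E) ->
  covariance Q (fun t => F (X t) (Y t) w) (fun t => F (X t) (W t) w) =
  (\int[Q]_t (F (X t) (Y t) w * F (X t) (W t) w)%:E)%E.
Proof.
move=> mX mY mW hY hW; rewrite unlock !(fine_expectation_skew w _ _ hY)//.
rewrite (fine_expectation_skew w _ _ hW)// unlock.
apply: eq_integral => t _; congr (_%:E).
by rewrite -[RHS]/((_ : R) * _) -[F (X t) (Y t) w in RHS]subr0 -[F (X t) (W t) w in RHS]subr0.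
Qed.

(** The integrand is a square, so Tonelli exchanges the two expectations. *)
Lemma sigma2_skew (X Y : Omega' -> E) :
  measurable_fun setT X -> measurable_fun setT Y ->
  (forall A B, measurable A -> measurable B ->
    Q (X @^-1` A `&` Y @^-1` B) = (piX A * piX B)%E) ->
  sigma2 P Q F X Y = (\int[Q]_t \int[P]_w (F (X t) (Y t) w ^+ 2)%:E)%E.
Proof.
move=> mX mY h; rewrite /sigma2 /variance.
under eq_integral do rewrite (covariance_skew _ mX mY mY h h).
rewrite (fubini_tonelli (fun q => (F (X q.2) (Y q.2) q.1 * F (X q.2) (Y q.2) q.1)%:E))//.
- apply/measurable_EFinP; apply: measurable_funM; exact: measurable_skew_comp.
- by move=> q; rewrite lee_fin -expr2 sqr_ge0.
Qed.

(** The product is signed, so Fubini requires absolute integrability on the product space; it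
    follows from |a b| <= a^2 + b^2 and the uniform bound [B] on second moments. *)
Lemma shared_endpoint_cov_skew (X Y W : Omega' -> E) (B : R) :
  measurable_fun setT X -> measurable_fun setT Y -> measurable_fun setT W ->
  (forall A B, measurable A -> measurable B ->
    Q (X @^-1` A `&` Y @^-1` B) = (piX A * piX B)%E) ->
  (forall A B, measurable A -> measurable B ->
    Q (X @^-1` A `&` W @^-1` B) = (piX A * piX B)%E) ->
  (forall x y, \int[P]_w (F x y w ^+ 2)%:E <= B%:E)%E ->
  shared_endpoint_cov P Q F X Y W =
  (\int[Q]_t \int[P]_w (F (X t) (Y t) w * F (X t) (W t) w)%:E)%E.
Proof.
move=> mX mY mW hY hW FB; rewrite /shared_endpoint_cov.
under eq_integral do rewrite (covariance_skew _ mX mY mW hY hW).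
pose f (q : Omega * Omega') := (F (X q.2) (Y q.2) q.1 * F (X q.2) (W q.2) q.1)%:E.
have mXY := measurable_skew_comp mX mY; have mXW := measurable_skew_comp mX mW.
have mf : measurable_fun setT f by apply/measurable_EFinP; exact: measurable_funM.
have B0 : 0 <= B.
  rewrite -lee_fin; apply: le_trans (FB point point).
  by apply: integral_ge0 => w _; rewrite lee_fin sqr_ge0.
apply: (Fubini (f := f)); apply/integrable21ltyP => //.
apply: (@le_lt_trans _ _ (\int[Q]_t (B + B)%:E)%E); last first.
  rewrite (_ : (\int[Q]_t _)%E = ((B + B)%:E * Q setT)%E); last exact: integral_cst.
  by rewrite probability_setT mule1 ltry.
apply: ge0_le_integral => //.
- by move=> t _; exact: integral_ge0.
- apply: (measurable_fun_fubini_tonelli_G (fun q => `|f q|)%E) => //.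
  exact: measurableT_comp.
- move=> t _; rewrite EFinD.
  apply: le_trans (leeD (FB (X t) (Y t)) (FB (X t) (W t))).
  have ms x y : measurable_fun setT (fun w => (F x y w ^+ 2)%:E).
    apply/measurable_EFinP; apply: measurable_funX.
    apply: (@measurableT_comp _ _ _ _ _ _ (fun q : (E * E) * Omega => F q.1.1 q.1.2 q.2)
      _ (fun w => ((x, y), w))) => //; exact: measurable_fun_pair.
  have s0 x y w : (0 <= (F x y w ^+ 2)%:E)%E by rewrite lee_fin sqr_ge0.
  rewrite -ge0_integralD//; apply: ge0_le_integral => //.
  + by apply: measurableT_comp => //; exact: measurableT_comp.
  + by apply: emeasurable_funD.
  + move=> w _; rewrite /f /= -EFinD lee_fin normrM.
    rewrite -[in leRHS](real_normK (num_real (F (X t) (Y t) w))).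
    rewrite -[in leRHS](real_normK (num_real (F (X t) (W t) w))).
    have := normr_ge0 (F (X t) (Y t) w); have := normr_ge0 (F (X t) (W t) w).
    move: `|F (X t) (Y t) w| `|F (X t) (W t) w| => p q p0 q0.
    by have := sqr_ge0 (p - q); nra.
Qed.
End random_skew_function.

(** * Asymptotics in the roughness *)

(** Bernoulli's inequality in the variable 1 - x. *)
Lemma subr_expn_le (R : realFieldType) (x : R) n : 0 <= x <= 1 -> 1 - x ^+ n <= n%:R * (1 - x).
Proof.
move=> /andP[x0 x1]; elim: n => [|n IH]; first by rewrite expr0 subrr mul0r.
have xn : 0 <= 1 - x ^+ n by rewrite subr_ge0 exprn_ile1.
rewrite exprS -natr1 mulrDl mul1r; nra.
Qed.

Definition rho_gauss (R : realType) (T : nat) (r : R) : R :=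
  ((Num.sqrt (1 + 2 * r ^+ 2)) ^- T -
   (Num.sqrt ((1 + r ^+ 2) * (1 + 3 * r ^+ 2))) ^- T) /
  (1 - (Num.sqrt (1 + 4 * r ^+ 2)) ^- T).

(** The difference is (A - L - B + L C) / (1 - C), with [L] the leading term and A = (1 + 2
    r^2)^(-T/2). Here L - A is at most T r^-(T+2), both B and L C are at most r^-(2T), and 1 - C >=
    1/2 doubles the total, whence 2 T + 4. *)
Lemma rho_gauss_bound (R : realType) (T : nat) (r : R) : (1 <= T)%N -> 1 <= r ->
  `|rho_gauss T r - (Num.sqrt 2 * r) ^- T| <=
  (2 * T%:R + 4) * (r ^- (2 * T) + r ^- (T + 2)).
Proof.
move=> T1 r1; rewrite /rho_gauss.
have r0 : 0 < r by exact: lt_le_trans ltr01 r1.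
have r0' := ltW r0.
have s2 : 1 <= Num.sqrt (2 : R) by rewrite -[leLHS]sqrtr1 ler_sqrt// ler1n.
set p := Num.sqrt 2 * r; set q := Num.sqrt (1 + 2 * r ^+ 2).
have p2 : p ^+ 2 = 2 * r ^+ 2 by rewrite exprMn sqr_sqrtr.
have q2 : q ^+ 2 = 1 + 2 * r ^+ 2 by rewrite sqr_sqrtr// addr_ge0// mulr_ge0// sqr_ge0.
have rp : r <= p by rewrite ler_peMl.
have p0 : 0 < p by exact: lt_le_trans r0 rp.
have q0 : 0 <= q by rewrite sqrtr_ge0.
have pq : p <= q.
  have : p ^+ 2 <= q ^+ 2 by rewrite p2 q2 lerDr.
  by rewrite ler_pXn2r ?nnegrE ?(ltW p0).
have q_gt0 : 0 < q by exact: lt_le_trans pq.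
have inv_le (a b : R) n : 0 < a -> a <= b -> b ^- n <= a ^- n.
  move=> a0 ab; have b0 := lt_le_trans a0 ab.
  by rewrite lef_pV2 ?posrE ?exprn_gt0// lerXn2r// nnegrE ltW.
set A := q ^- T; set L := p ^- T.
set B := Num.sqrt _ ^- T; set C := Num.sqrt _ ^- T.
have Lr : L <= r ^- T by exact: inv_le.
have L0 : 0 < L by rewrite invr_gt0 exprn_gt0.
have AL : A <= L by exact: inv_le.
have LA : L - A <= T%:R * r ^- (T + 2).
  have x01 : 0 <= p / q <= 1.
    apply/andP; split; first by rewrite divr_ge0// ltW.
    by rewrite ler_pdivrMr// mul1r.
  have -> : L - A = L * (1 - (p / q) ^+ T).
    rewrite /L /A expr_div_n mulrBr mulr1; congr (_ - _).
    by rewrite mulKf// expf_neq0// gt_eqF.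
  have h := subr_expn_le T x01.
  (* Since q^2 - p^2 = 1, the gap is 1 / ((q + p) q), and both p and q are at least r. *)
  have h2 : 1 - p / q <= r ^- 2.
    have -> : 1 - p / q = ((q + p) * q)^-1.
      have : (q - p) * (q + p) = 1 by rewrite -subr_sqr q2 p2; ring.
      have qp0 : q + p != 0 by rewrite gt_eqF// addr_gt0.
      move=> e; have -> : 1 - p / q = (q - p) / q by field; rewrite gt_eqF.
      by rewrite invfM; congr (_ / _); apply: (mulIf qp0); rewrite e mulVf.
    rewrite lef_pV2 ?posrE ?exprn_gt0// ?mulr_gt0 ?addr_gt0//.
    have := le_trans rp pq; nra.
  rewrite exprD invfM mulrCA ler_pM//; first exact: ltW.
    by rewrite subr_ge0 exprn_ile1//; case/andP: x01.
  by rewrite (le_trans h)// ler_wpM2l.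
have B0 : 0 <= B by rewrite invr_ge0 exprn_ge0// sqrtr_ge0.
have Br : B <= r ^- (2 * T).
  rewrite exprM; apply: inv_le; first by rewrite exprn_gt0.
  rewrite -[leLHS]ger0_norm ?sqr_ge0// -sqrtr_sqr ler_wsqrtr//.
  by have := sqr_ge0 r; nra.
have C0 : 0 <= C by rewrite invr_ge0 exprn_ge0// sqrtr_ge0.
have C2r : C <= (2 * r) ^- T.
  apply: inv_le; first by rewrite mulr_gt0.
  rewrite -[leLHS]ger0_norm ?mulr_ge0// -sqrtr_sqr ler_wsqrtr//.
  by rewrite exprMn; nra.
have Cr : C <= r ^- T by rewrite (le_trans C2r)// inv_le// ler_peMl// ler1n.
(* [1 <= T] enters here: (2 r)^T >= 2 keeps the denominator away from 0. *)
have C12 : C <= 1 / 2.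
  rewrite (le_trans C2r)// (@le_trans _ _ (2 ^- T))//; first by rewrite inv_le//; lra.
  rewrite div1r lef_pV2 ?posrE ?exprn_gt0//.
  by rewrite -[leLHS]expr1 ler_eXn2l// ltr1n.
have C1 : 0 < 1 - C by lra.
have LC : L * C <= r ^- (2 * T).
  by rewrite mul2n -addnn exprD invfM ler_pM// ltW.
have -> : (A - B) / (1 - C) - L = (A - L - B + L * C) / (1 - C).
  by field; rewrite gt_eqF.
rewrite normrM [X in _ * X]ger0_norm; last by rewrite invr_ge0 ltW.
have I2 : (1 - C)^-1 <= 2.
  by rewrite -[leRHS]invrK lef_pV2 ?posrE ?invr_gt0//; lra.
have Bd : `|A - L - B + L * C| <= T%:R * r ^- (T + 2) + 2 * r ^- (2 * T).
  by rewrite ler_norml; have := mulr_ge0 (ltW L0) C0; lra.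
rewrite (le_trans (ler_pM _ _ Bd I2))// ?invr_ge0 ?(ltW C1)//.
have a0 : 0 <= r ^- (T + 2) by rewrite invr_ge0 exprn_ge0.
have b0 : 0 <= r ^- (2 * T) by rewrite invr_ge0 exprn_ge0.
have T0 : 0 <= T%:R :> R by [].
have := mulr_ge0 T0 b0; nra.
Qed.

Lemma exprVn_le (R : realFieldType) (r : R) (m n : nat) : 1 <= r -> (m <= n)%N ->
  r ^- n <= r ^- m.
Proof.
move=> r1 mn; have r0 := lt_le_trans ltr01 r1.
by rewrite lef_pV2 ?posrE ?exprn_gt0// ler_weXn2l.
Qed.

Section rho_gauss_asymptotics.
Variables (R : realType) (T : nat).
Hypothesis T1 : (1 <= T)%N.
Let rho := @rho_gauss R T.
Let lead := fun r : R => (Num.sqrt 2 * r) ^- T.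
Let K : R := 2 * T%:R + 4.
Let K0 : 0 < K. Proof. by rewrite ltr_wpDl// mulr_ge0. Qed.

(** As T >= 1, both exponents 2 T and T + 2 are at least T + 1; one power beyond the leading term
    suffices for the equivalence and for the limit. *)
Let rho_lead_le (r : R) : 1 <= r -> `|rho r - lead r| <= 2 * K * r ^- T.+1.
Proof.
move=> r1; apply: le_trans (rho_gauss_bound T1 r1) _.
rewrite -/K [2 * K]mulrC -mulrA ler_pM2l// mulr_natl mulr2n.
by apply: lerD; apply: exprVn_le => //; rewrite ?mul2n -?addnn -addn1 leq_add2l.
Qed.

Lemma rho_gauss_equiv : rho ~_ (pinfty_nbhs R) (lead \+ cst 0).
Proof.
apply/eqaddoP => e e0; near=> r.
have r1 : 1 <= r by near: r; exact: nbhs_pinfty_ge.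
have r0 := lt_le_trans ltr01 r1.
have s0 : 0 < Num.sqrt (2 : R) by rewrite sqrtr_gt0.
rewrite -[X in `|X| <= _]/(rho r - (lead r + 0)) -[X in _ * `|X|]/(lead r + 0) addr0.
apply: le_trans (rho_lead_le r1) _.
rewrite /lead exprMn invfM ger0_norm; last first.
  by rewrite mulr_ge0 ?invr_ge0 ?exprn_ge0 ?ltW.
rewrite exprSr invfM.
rewrite (_ : 2 * K * _ = r ^- T * (2 * K / r)); last by ring.
rewrite (_ : e * _ = r ^- T * (e / Num.sqrt 2 ^+ T)); last by ring.
apply: ler_wpM2l; first by rewrite invr_ge0 exprn_ge0// ltW.
rewrite ler_pdivrMr// mulrAC ler_pdivlMr ?exprn_gt0//.
rewrite -(ler_pdivrMl _ _ e0).
(* After cancelling r^-T the threshold on [r] is 2 K (sqrt 2)^T / e. *)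
by near: r; apply: nbhs_pinfty_ge; rewrite num_real.
Unshelve. all: by end_near. Qed.

Lemma rho_gauss_bigO :
  (rho \- lead) =O_ (pinfty_nbhs R) (fun r => r ^- (2 * T) + r ^- (T + 2)).
Proof.
apply/eqO_exP; exists K => //; near=> r.
have r1 : 1 <= r by near: r; exact: nbhs_pinfty_ge.
have r0 := lt_le_trans ltr01 r1.
apply: le_trans (rho_gauss_bound T1 r1) _; rewrite -/K ler_pM2l//.
by rewrite ler_norm.
Unshelve. all: by end_near. Qed.

(** For T <= 2 one has 2 T <= T + 2, so r^-(T+2) is absorbed into r^-(2T). *)
Lemma rho_gauss_bigO_small : (T <= 2)%N ->
  (rho \- lead) =O_ (pinfty_nbhs R) (fun r => r ^- (2 * T)).
Proof.
move=> T2; apply/eqO_exP; exists (2 * K); first by rewrite mulr_gt0.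
near=> r.
have r1 : 1 <= r by near: r; exact: nbhs_pinfty_ge.
have r0 := lt_le_trans ltr01 r1.
apply: le_trans (rho_gauss_bound T1 r1) _; rewrite -/K.
rewrite [2 * K]mulrC -mulrA ler_pM2l// mulr_natl mulr2n.
apply: lerD; first exact: ler_norm.
by apply: le_trans (ler_norm _); apply: exprVn_le => //; rewrite mul2n -addnn leq_add2l.
Unshelve. all: by end_near. Qed.

Lemma rho_gauss_cvg0 : rho r @[r --> +oo] --> 0.
Proof.
apply/cvgr0Pnorm_le => e e0; near=> r.
have r1 : 1 <= r by near: r; exact: nbhs_pinfty_ge.
have r0 := lt_le_trans ltr01 r1.
have s2 : 1 <= Num.sqrt (2 : R) by rewrite -[leLHS]sqrtr1 ler_sqrt// ler1n.
have leadr : `|lead r| <= r^-1.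
  have p0 : 0 < Num.sqrt 2 * r by rewrite mulr_gt0// (lt_le_trans _ s2).
  rewrite ger0_norm; last by rewrite invr_ge0 exprn_ge0// ltW.
  rewrite lef_pV2 ?posrE ?exprn_gt0//.
  have rp : r <= Num.sqrt 2 * r by rewrite ler_peMl// ltW.
  apply: le_trans rp _; rewrite -[leLHS]expr1 ler_weXn2l//.
  by rewrite (le_trans r1)// ler_peMl// ltW.
have := rho_lead_le r1; have := exprVn_le r1 (ltn0Sn T); rewrite expr1 => h1 h2.
have h : `|rho r| <= (1 + 2 * K) / r.
  rewrite -[rho r](subrK (lead r)) (le_trans (ler_normD _ _))//.
  rewrite mulrDl mul1r addrC lerD// (le_trans h2)// ler_pM2l// mulr_gt0//.
apply: le_trans h _; rewrite ler_pdivrMr// -(ler_pdivrMl _ _ e0).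
by near: r; apply: nbhs_pinfty_ge; rewrite num_real.
Unshelve. all: by end_near. Qed.
End rho_gauss_asymptotics.

(** * The shared-endpoint correlation *)

Lemma integral_EFin_Rintegral d (T : measurableType d) (R : realType)
    (m : {measure set T -> \bar R}) (f : T -> R) :
  m.-integrable setT (EFin \o f) ->
  (\int[m]_x (f x)%:E = (\int[m]_x f x)%:E)%E.
Proof.
by move=> mf; rewrite /Rintegral fineK//; exact: (integrable_fin_num measurableT mf).
Qed.

Lemma gauss_distC (R : realType) T (c : R) (x y : T.-tuple R) :
  gauss_dist c (tnth y) x = gauss_dist c (tnth x) y.
Proof. by rewrite /gauss_dist sumr_sqr_distC. Qed.

Lemma gauss_distxx (R : realType) T (c : R) (x : T.-tuple R) :
  gauss_dist c (tnth x) x = 1.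
Proof.
rewrite /gauss_dist big1; first by rewrite mulr0 oppr0 mul0r expR0.
by move=> i _; rewrite subrr expr0n.
Qed.

Lemma gauss_dist_sqr (R : realType) T (c : R) (a : 'I_T -> R) (x : T.-tuple R) :
  gauss_dist c a x ^+ 2 = gauss_dist (2 * c) a x.
Proof. by rewrite /gauss_dist expr2 -expRD; congr expR; field. Qed.

Lemma sq_exp_kernel_scalar (R : realType) (T : nat) (su c : R) (Su : 'M[R]_T) p q :
  invmx Su = c%:M ->
  sq_exp_kernel su Su p q =
  su ^+ 2 * (gauss_dist c (tnth q.1) p.1 * gauss_dist c (tnth q.2) p.2).
Proof.
move=> SuE; rewrite /sq_exp_kernel SuE /gauss_dist -expRD; congr (_ * expR _).
have qE (x y : T.-tuple R) :
    quad_form c%:M (colv x - colv y) = c * \sum_i (tnth x i - tnth y i) ^+ 2.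
  by rewrite quad_form_scalar; congr (_ * _); apply: eq_bigr => i _; rewrite !mxE.
by rewrite !qE; field.
Qed.

Section shared_endpoint.
Variables (R : realType) (T : nat) (d d' : measure_display).
Variables (Omega : measurableType d) (Omega' : measurableType d').
Variables (P : probability Omega R) (Q : probability Omega' R).
Variables (su c : R) (Su : 'M[R]_T).
Variables (U : T.-tuple R * T.-tuple R -> Omega -> R).
Variables (m : T.-tuple R * T.-tuple R -> R) (sx : R) (mean : 'cV[R]_T).
Variables (piX : probability (T.-tuple R) R) (X Y W : {mfun Omega' >-> T.-tuple R}).
Hypothesis c0 : 0 <= c.
Hypothesis SuE : invmx Su = c%:M.
Hypothesis mU : measurable_fun [set: (T.-tuple R * T.-tuple R) * Omega]
  (fun q => U q.1 q.2).
Hypothesis UG : gaussian_process P U m (sq_exp_kernel su Su).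
Hypothesis EF0 : forall x y, ('E_P[skew_part U x y] = 0)%E.
Hypothesis piN : multivariate_normal piX (fun i x => tnth x i) mean ((sx ^+ 2)%:M).
Hypothesis iid : iid3 Q piX X Y W.

Let mX : measurable_fun setT X. Proof. exact: measurable_funPT. Qed.
Let mY : measurable_fun setT Y. Proof. exact: measurable_funPT. Qed.
Let mW : measurable_fun setT W. Proof. exact: measurable_funPT. Qed.

Let lawXYW A B C : measurable A -> measurable B -> measurable C ->
  Q (X @^-1` A `&` Y @^-1` B `&` W @^-1` C) = (piX A * piX B * piX C)%E.
Proof.
by move=> mA mB mC; have [hX hY hW ->] := iid; rewrite // -hX// -hY// -hW.
Qed.

Let lawXY A B : measurable A -> measurable B ->
  Q (X @^-1` A `&` Y @^-1` B) = (piX A * piX B)%E.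
Proof.
move=> mA mB; have := lawXYW mA mB measurableT.
by rewrite preimage_setT setIT probability_setT mule1.
Qed.

Let lawXW A B : measurable A -> measurable B ->
  Q (X @^-1` A `&` W @^-1` B) = (piX A * piX B)%E.
Proof.
move=> mA mB; have := lawXYW mA measurableT mB.
by rewrite preimage_setT setIT probability_setT mule1.
Qed.

Let lawYW A B : measurable A -> measurable B ->
  Q (Y @^-1` A `&` W @^-1` B) = (piX A * piX B)%E.
Proof.
move=> mA mB; have := lawXYW measurableT mA mB.
by rewrite preimage_setT setTI probability_setT mul1e.
Qed.

Let mF : measurable_fun setT
  (fun q : (T.-tuple R * T.-tuple R) * Omega => skew_part U q.1.1 q.1.2 q.2).
Proof.
apply: measurable_funB.
  by rewrite (_ : (fun q => _) = fun q => U q.1 q.2)//; apply/funext => -[[]].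
have mG : measurable_fun setT
    (fun q : (T.-tuple R * T.-tuple R) * Omega => ((q.1.2, q.1.1), q.2)).
  apply: measurable_fun_pair; last exact: measurable_snd.
  apply: measurable_fun_pair.
    exact: (measurableT_comp measurable_snd measurable_fst).
  exact: (measurableT_comp measurable_fst measurable_fst).
exact: (measurableT_comp mU mG).
Qed.

Let FN x y w : skew_part U y x w = - skew_part U x y w.
Proof. by rewrite /skew_part opprB. Qed.

Let kE p q := sq_exp_kernel_scalar su p q SuE.

Let ik (x y : Omega' -> T.-tuple R) (c' : R) : 0 <= c' ->
  measurable_fun setT x -> measurable_fun setT y ->
  Q.-integrable setT (EFin \o (fun t => gauss_dist c' (tnth (y t)) (x t))).
Proof.
move=> c'0 mx my.
apply: (integrable_bounded _ _ (fun t => normr_gauss_dist_le1 _ _ _)) => //.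
exact: measurable_gauss_dist.
Qed.

(** The square of the kernel is the kernel with parameter 2 c, so the pair integral is taken at 2 c
    and produces 1 + 4 sx^2 c. *)
Lemma sigma2_sq_exp : sigma2 P Q (skew_part U) X Y =
  (2 * su ^+ 2 * (1 - (Num.sqrt (1 + 4 * (sx ^+ 2 * c))) ^- T))%:E.
Proof.
have c2 : 0 <= 2 * c by rewrite mulr_ge0.
rewrite (sigma2_skew P mF FN mX mY lawXY).
under eq_integral do rewrite (integral_skew_sqr1 kE (@gauss_distC _ _ c)
  (@gauss_distxx _ _ c) UG EF0) gauss_dist_sqr.
have i1 : Q.-integrable setT (EFin \o (fun t => 1 - gauss_dist (2 * c) (tnth (Y t)) (X t))).
  have ic : Q.-integrable setT (EFin \o cst (1:R)).
    exact: finite_measure_integrable_cst.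
  by have := integrableB measurableT ic (ik c2 mX mY); apply: eq_integrable.
rewrite integral_EFin_Rintegral; last exact: (integrableZl measurableT _ i1).
rewrite RintegralZl// RintegralB//; [|exact: finite_measure_integrable_cst|exact: ik].
rewrite Rintegral_probability_cst (Rintegral_gauss_pair piN mX mY c2 lawXY).
by congr (_ * (1 - Num.sqrt (1 + _) ^- T))%:E; ring.
Qed.

(** kappa(Y, W) contributes the pair integral and kappa(X, Y) kappa(X, W) the triple one; the Fubini
    bound is 2 su^2, because 1 - kappa^2 <= 1. *)
Lemma shared_endpoint_cov_sq_exp :
  shared_endpoint_cov P Q (skew_part U) X Y W =
  (2 * su ^+ 2 * ((Num.sqrt (1 + 2 * (sx ^+ 2 * c))) ^- T -
    (Num.sqrt ((1 + sx ^+ 2 * c) * (1 + 3 * (sx ^+ 2 * c)))) ^- T))%:E.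
Proof.
rewrite (shared_endpoint_cov_skew (P := P) mF FN mX mY mW lawXY lawXW
  (B := 2 * su ^+ 2)); last first.
  move=> x y; rewrite (integral_skew_sqr1 kE (@gauss_distC _ _ c) (@gauss_distxx _ _ c) UG EF0).
  rewrite lee_fin; apply: ler_piMr; first by rewrite mulr_ge0// sqr_ge0.
  by rewrite lerBlDr lerDl sqr_ge0.
under eq_integral do rewrite (integral_skew_mul kE (@gauss_distC _ _ c)
  (@gauss_distxx _ _ c) UG EF0).
have i2 : Q.-integrable setT (EFin \o (fun t =>
    gauss_dist c (tnth (Y t)) (X t) * gauss_dist c (tnth (W t)) (X t))).
  apply: (@integrable_bounded _ _ _ _ _ 1).
    by apply: measurable_funM; exact: measurable_gauss_dist.
  by move=> t; rewrite normrM mulr_ile1// normr_gauss_dist_le1.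
have i1 := ik c0 mY mW.
rewrite integral_EFin_Rintegral; last first.
  exact: (integrableZl measurableT _ (integrableB measurableT i1 i2)).
rewrite RintegralZl//; last exact: (integrableB measurableT i1 i2).
rewrite RintegralB// (Rintegral_gauss_pair piN mY mW c0 lawYW).
by rewrite (Rintegral_gauss_triple piN mX mY mW c0 lawXYW).
Qed.

End shared_endpoint.

(** [rho] is chosen before the probability spaces, the process and the attributes, which expresses
    that the correlation depends only on [r] and [T]. *)
Theorem mainTheorem3 (R : realType) (T : nat) (hT : (1 <= T)%N) :
  exists rho : R -> R,
    (forall (d d' : measure_display)
        (Omega : measurableType d) (Omega' : measurableType d')
        (P : probability Omega R) (Q : probability Omega' R)
        (* the Gaussian process, jointly measurable *)
        (su : R) (Su : 'M[R]_T)
        (U : T.-tuple R * T.-tuple R -> Omega -> R)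
        (m : T.-tuple R * T.-tuple R -> R)
        (* the attributes *)
        (sx : R) (mu : 'cV[R]_T)
        (piX : probability (T.-tuple R) R)
        (X Y W : {mfun Omega' >-> T.-tuple R})
        (r : R),
      0 < su -> sym_posdef Su ->
      measurable_fun [set: (T.-tuple R * T.-tuple R) * Omega]
        (fun q => U q.1 q.2) ->
      gaussian_process P U m (sq_exp_kernel su Su) ->
      (forall x y, ('E_P[skew_part U x y] = 0)%E) ->
      multivariate_normal piX (fun i x => tnth x i) mu ((sx ^+ 2)%:M) ->
      iid3 Q piX X Y W ->
      0 < r ->
      invmx Su *m (sx ^+ 2)%:M = (r ^+ 2)%:M ->
      shared_endpoint_corr P Q (skew_part U) X Y W = (rho r)%:E)
    /\
    (let lead := fun r : R => (Num.sqrt 2 * r) ^- T in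
     [/\ exists h : R -> R,
           h =O_ (pinfty_nbhs R) (fun r => r ^- (2 * T)) /\
           rho ~_ (pinfty_nbhs R) (lead \+ h),
         (rho \- lead) =O_ (pinfty_nbhs R)
           (fun r => r ^- (2 * T) + r ^- (T + 2)),
         (T <= 2)%N ->
           (rho \- lead) =O_ (pinfty_nbhs R) (fun r => r ^- (2 * T))
       & rho r @[r --> +oo] --> 0]).
Proof.
exists (rho_gauss T); split; last first.
  split.
  (* The zero remainder is a valid witness, since [~_] controls only the error relative to the
     leading term. *)
  - exists (cst 0); split; last exact: rho_gauss_equiv.
    apply/eqO_exP; exists 1 => //; near=> r.
    by rewrite normr0 mul1r.
  - exact: rho_gauss_bigO.
  - exact: rho_gauss_bigO_small.
  - exact: rho_gauss_cvg0.
move=> d d' Omega Omega' P Q su Su U m sx mean piX X Y W r su0 _ mU UG EF0 piN iid r0 SuE.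
(* The roughness identity excludes [sx = 0]: at a diagonal entry, which exists as 1 <= T, it would
   read 0 = r^2. *)
have sx0 : sx ^+ 2 != 0.
  apply/eqP => sx0; move: SuE; rewrite sx0 mul_mx_scalar scale0r.
  move/matrixP => /(_ (Ordinal hT) (Ordinal hT)); rewrite !mxE eqxx mulr1n.
  by move/esym/eqP; rewrite expf_eq0/= gt_eqF.
pose c := r ^+ 2 / sx ^+ 2.
have c0 : 0 <= c by rewrite divr_ge0// sqr_ge0.
have invE : invmx Su = c%:M.
  move: SuE; rewrite mul_mx_scalar => /(congr1 ( *:%R (sx ^+ 2)^-1)).
  by rewrite scalerA mulVf// scale1r scale_scalar_mx mulrC.
have scE : sx ^+ 2 * c = r ^+ 2 by rewrite /c mulrCA mulfV// mulr1.
rewrite /shared_endpoint_corr (sigma2_sq_exp c0 invE mU UG EF0 piN iid).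
rewrite (shared_endpoint_cov_sq_exp c0 invE mU UG EF0 piN iid) scE /=.
(* The common scale 2 su^2 cancels, which leaves a function of [r] and [T] alone. *)
rewrite -EFinM; congr (_%:E); rewrite /rho_gauss invfM mulrACA mulVf ?mul1r.
  by rewrite mulrC.
by rewrite gt_eqF// mulr_gt0// exprn_gt0.
Unshelve. all: by end_near. Qed.
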